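(* Let $\alpha>0$, $L>0$, and let $\mathcal{H}$ be an infinite dimensional Hilbert space with fixed orthonormal basis $\{|e_0\rangle,|e_1\rangle,\dots\}$. Consider the i.i.d. quantum model $\mathcal{Q}_n=\{|\psi\rangle\langle\psi|^{\otimes n}:|\psi\rangle\langle\psi|\in S^\alpha(L)\}$. There exists an estimator $\widehat\rho_n=|\widehat\psi_n\rangle\langle\widehat\psi_n|$ such that $$\limsup_{n\to\infty}\ \sup_{|\psi\rangle\in S^\alpha(L)} n^{2\alpha/(2\alpha+1)}\,\mathbb{E}_\rho\left[d^2(\widehat\rho_n,\rho)\right]\le C,$$ where $\rho=|\psi\rangle\langle\psi|$, $d(\widehat\rho_n,\rho)$ denotes either the trace-norm distance or the Bures distance, and $C>0$ is a constant depending only on $\alpha$ and $L$.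
   Context: The Hermite-Sobolev class is $S^\alpha(L)=\{|\psi\rangle\langle\psi|:\ \sum_{j=0}^\infty|\psi_j|^2j^{2\alpha}\le L,\ \|\psi\|=1\}$, where $\psi_j=\langle e_j|\psi\rangle$. Writing $|\psi\rangle\in S^\alpha(L)$ means $|\psi\rangle\langle\psi|\in S^\alpha(L)$. An estimator is the (random) result of a quantum measurement on $\rho^{\otimes n}$ followed by a classical estimator, i.e. the outcome of a positive operator valued measure $M$ on $\mathcal{H}^{\otimes n}$ ($M(E)\ge0$, $\sigma$-additive, total mass $\mathbf 1$), possibly processed by a classical map, with values in the pure states of $\mathcal{H}$; the outcome of $M$ has law $E\mapsto\mathrm{Tr}(\rho^{\otimes n}M(E))$ and $\mathbb{E}_\rho$ is the corresponding expectation. The trace-norm distance is $\|\rho-\rho'\|_1=\mathrm{Tr}|\rho-\rho'|$, and the Bures distance $d_b$ is given by $d_b^2(\rho,\rho')=2\big(1-\mathrm{Tr}\sqrt{\sqrt{\rho}\rho'\sqrt{\rho}}\big)$. For pure states $\rho=|\psi\rangle\langle\psi|$, $\rho'=|\psi'\rangle\langle\psi'|$ these equal $2\sqrt{1-|\langle\psi|\psi'\rangle|^2}$ and $d_b^2=2(1-|\langle\psi|\psi'\rangle|)$ respectively. *)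

(* Defs.v *)
From HB Require Import structures.
From mathcomp Require Import all_boot all_order all_algebra sesquilinear.
From mathcomp Require Import all_classical all_reals all_analysis.
From mathcomp Require Import complex.

Set Implicit Arguments.
Unset Strict Implicit.
Unset Printing Implicit Defensive.

Import Order.TTheory GRing.Theory Num.Theory.
Import numFieldNormedType.Exports.

Local Open Scope classical_set_scope.
Local Open Scope ring_scope.

(* MathComp's sesquilinear forms are linear on the left and conjugate-linear
   on the right; [braket] below restores the Dirac convention. *)
Record hilbert (R : realType) := Hilbert {
  hilbert_space :> completeNormedModType R[i];
  inner : {dot hilbert_space for @Num.conj R[i]};
  inner_norm : forall x : hilbert_space, inner x x = `|x| ^+ 2 }.

Definition braket (R : realType) (H : hilbert R) (u v : H) : R[i] := inner H v u.

Definition lspan (R : realType) (H : hilbert R) (S : set H) : set H :=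
  [set x | exists (m : nat) (c : 'I_m -> R[i]) (v : 'I_m -> H),
     (forall i, S (v i)) /\ x = \sum_(i < m) c i *: v i].

Definition orthonormal_basis (R : realType) (H : hilbert R) (I : countType)
    (f : I -> H) : Prop :=
  (forall i j, braket (f i) (f j) = (i == j)%:R) /\ dense (lspan (range f)).

Section Operators.
Variables (R : realType) (H : hilbert R).
Implicit Types (A B : H -> H) (psi : H).

Definition bounded_op A : Prop := linear A /\ continuous A.

(* [0 <= z] in R[i] forces z to be real, so [psd] operators are self-adjoint. *)
Definition psd A : Prop := bounded_op A /\ forall x, 0 <= braket x (A x).

(* The operators below are selected by [xget]: they exist and are unique for the
   arguments of interest (the default value 0 is returned otherwise). *)
Definition adjoint A : H -> H :=
  xget (fun=> 0) [set B | bounded_op B /\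
                          forall x y, braket (B x) y = braket x (A y)].

Definition sqrt_op A : H -> H := xget (fun=> 0) [set S | psd S /\ S \o S = A].

Definition abs_op A : H -> H := sqrt_op (adjoint A \o A).

(* The sum over [I] is taken in the order given by the pickling of [I]; as [f]
   runs over all orthonormal bases the order is immaterial. *)
Definition has_trace A (t : R[i]) : Prop :=
  forall (I : countType) (f : I -> H), orthonormal_basis f ->
    \sum_(k < N) oapp (fun i => braket (f i) (A (f i))) 0 (@pickle_inv I k)
      @[N --> \oo] --> (t : R[i]^o).

Definition op_trace A : R[i] := xget 0 [set t | has_trace A t].

Definition trdist A B : R := complex.Re (op_trace (abs_op (A \- B))).

Definition bures A B : R :=
  Num.sqrt (2 * (1 - complex.Re
    (op_trace (sqrt_op (sqrt_op A \o B \o sqrt_op A))))).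

Definition ketbra psi : H -> H := fun x => braket psi x *: psi.

Definition pure_states : set (H -> H) :=
  [set ketbra psi | psi in [set psi | `|psi| = 1]].

Definition sobolev_class (e : nat -> H) (alpha L : R) : set (H -> H) :=
  [set ketbra psi | psi in [set psi | `|psi| = 1 /\
     (\sum_(0 <= j <oo)
        (Normc.normc (braket (e j) psi) ^+ 2 * j%:R `^ (2 * alpha))%:E <= L%:E)%E]].

End Operators.

Arguments pure_states {R} H _.

(* A realisation of the n-fold Hilbert-space tensor power of H; it is unique up
   to a unitary compatible with [tens]. *)
Record tensor_power (R : realType) (H : hilbert R) (n : nat) := TensorPower {
  tensor_space :> hilbert R;
  tens : ('I_n -> H) -> tensor_space;
  tens_multilinear : forall (u : 'I_n -> H) (i : 'I_n) (a : R[i]) (x y : H),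
    tens [eta u with i |-> a *: x + y] =
    a *: tens [eta u with i |-> x] + tens [eta u with i |-> y];
  tens_braket : forall u v : 'I_n -> H,
    braket (tens u) (tens v) = \prod_(i < n) braket (u i) (v i);
  tens_dense : dense (lspan (range tens)) }.

(* The bounded operator A^{(x) n}, determined by its values on product vectors. *)
Definition op_power (R : realType) (H : hilbert R) (n : nat)
    (K : tensor_power H n) (A : H -> H) : K -> K :=
  xget (fun=> 0) [set T | bounded_op T /\
                          forall u, T (tens K u) = tens K (fun i => A (u i))].

Arguments op_power {R H n} K A _.

(* sigma-additivity is meant in the weak operator topology, which for positive
   operator valued measures is equivalent to the strong one. *)
Record povm (R : realType) (d : measure_display) (T : measurableType d)
    (K : hilbert R) := Povm {
  povm_op :> set T -> K -> K;
  povm_psd : forall E, measurable E -> psd (povm_op E);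
  povm_sigma_additive : forall F : nat -> set T,
    (forall k, measurable (F k)) -> trivIset setT F ->
    forall x y, \sum_(k < N) braket x (povm_op (F k) y) @[N --> \oo] -->
                (braket x (povm_op (\bigcup_k F k) y) : R[i]^o);
  povm_total : povm_op setT = id }.

(* [est_measurable]: measurability for the Borel sigma-algebra of the trace-norm
   distance on the pure states; when H is separable it is generated by balls. *)
Record estimator (R : realType) (H : hilbert R) (n : nat)
    (K : tensor_power H n) := Estimator {
  est_display : measure_display;
  est_outcome : measurableType est_display;
  est_povm : povm est_outcome K;
  est_map : est_outcome -> H -> H;
  est_pure : forall w, pure_states H (est_map w);
  est_measurable : forall (rho : H -> H) (r : R), pure_states H rho ->
    measurable [set w | trdist (est_map w) rho < r] }.

Section Risk.
Variables (R : realType) (H : hilbert R) (n : nat) (K : tensor_power H n).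

Definition outcome_law (d : measure_display) (T : measurableType d)
    (M : povm T K) (rho : H -> H) (E : set T) : \bar R :=
  (complex.Re (op_trace (op_power K rho \o M E)))%:E.

Definition risk (est : estimator K) (dist : (H -> H) -> (H -> H) -> R)
    (rho : H -> H) : \bar R :=
  (\int[outcome_law (est_povm est) rho]_w (dist (est_map w) rho ^+ 2)%:E)%E.

End Risk.

(* Main.v *)
(* [psi^(x)n] lives in the symmetric subspace of the n-th tensor power, which the
   coherent projections [|z^(x)n><z^(x)n| / n!] resolve when z is a standard complex
   Gaussian vector of C^N'.  The estimator measures this resolution, for N' huge, and
   returns the line spanned by [P z], the first N coordinates of the outcome z.  With
   [s = <psi, z>], the squared sine of the angle between psi and P z is at most
   [|s psi - P z|^2 / |s|^2], and the outcome z has density [|s|^(2n) / n!] with respect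
   to the Gaussian: the risk is bounded by Gaussian moments of order n, which Wick's
   formula turns into permanents.  One gets [(N + 1) / n + 2 |psi - P psi|^2], and
   [N ~ n^(1 / (2 alpha + 1))] balances the two terms.

   Only moments of order n matter, so the Gaussian is replaced by a finite design:
   independent coordinates with uniform phase in the (n+1)-st roots of unity and
   squared modulus following a truncated, rescaled geometric law, whose k-th moment
   lies between [(1 - delta) k!] and [k!].  The upper bound makes the sum of the effects
   at most 1, the lower one makes the remaining effect nearly improbable. *)

Require Import Defs.
From mathcomp Require Import all_boot all_order all_algebra.
From mathcomp Require Import fingroup perm cyclic separable cyclotomic sesquilinear ring lra.
From mathcomp Require Import all_classical all_reals all_analysis.
From mathcomp Require Import complex.

Set Implicit Arguments.
Unset Strict Implicit.
Unset Printing Implicit Defensive.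

Import Order.TTheory GRing.Theory Num.Theory.
Import numFieldNormedType.Exports.

Local Open Scope classical_set_scope.
Local Open Scope ring_scope.

(** Dividing by [|s|^2] in the angle estimate is harmless because the outcome density carries
    [|s|^(2n)]: one factor cancels and a polynomial moment of order [n] remains, which a finite
    design can reproduce. With finitely many effects the outcomes are natural numbers, all sets of
    outcomes are measurable, and laws and risks are finite sums. The price is that [psi] is cut at
    [N'] coordinates and that the moments are only approximately Gaussian. Both defects feed the
    remainder effect, whose outcome is charged 4, a bound for either squared distance. Its
    probability is at most [1 - (1 - eps) q'^n], with [q'] the mass of [psi] on the first [N']
    coordinates. Since the rate factor is at most [n], it suffices that [eps] and [n (1 - q')] be of
    order [1 / n]. The statistical error depends on [N] but not on [N'], so [N'] may be as large as
    this requires. *)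

(** * Permutations and fibers *)

(* The library has this for algC only. *)
Lemma prim_root_exists (C : numClosedFieldType) (n : nat) :
  (0 < n)%N -> exists z : C, n.-primitive_root z.
Proof.
move=> n_gt0; have [rs] := closed_field_poly_normal ('X^n - 1 : {poly C}).
rewrite (monicP (monicXnsubC _ n_gt0)) scale1r => split_Xn.
suff /hasP[z _ z_prim] : has n.-primitive_root rs by exists z.
apply: has_prim_root => //.
- by apply/allP => z; rewrite -root_prod_XsubC -split_Xn.
- by rewrite -separable_prod_XsubC -split_Xn separable_Xn_sub_1 // pnatr_eq0 -lt0n.
- by rewrite -ltnS -(size_prod_XsubC rs id) -split_Xn size_XnsubC.
Qed.

(** Splitting off the image of [ord0] is the expansion of a permanent along its first row; it drives
    both permutation sums below. *)
Lemma lift_perm_bij (n : nat) :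
  bijective (fun p : 'I_n.+1 * 'S_n => lift_perm ord0 p.1 p.2).
Proof.
apply: inj_card_bij => [[i s] [j t] /= E|].
  have ij : i = j by have := congr1 (fun u : 'S_n.+1 => u ord0) E; rewrite !lift_perm_id.
  rewrite -ij in E *; congr pair; apply/permP => k.
  have := congr1 (fun u : 'S_n.+1 => u (lift ord0 k)) E.
  by rewrite !lift_perm_lift => /lift_inj.
by rewrite card_prod !card_Sn card_ord factS.
Qed.

(** The exponent of the variable [x j] in the monomial [\prod_i x (f i)]. *)
Definition fiber_card (J : finType) (n : nat) (f : 'I_n -> J) (j : J) : nat :=
  \sum_i (f i == j).

Lemma fiber_cardS (J : finType) (n : nat) (f : 'I_n.+1 -> J) (k : 'I_n.+1) (j : J) :
  fiber_card f j = ((f k == j) + fiber_card (f \o lift k) j)%N.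
Proof. by rewrite /fiber_card (bigD1_ord k). Qed.

(** The permutations counted form a coset of the stabilizer of [f], whose order is the product of
    factorials, unless the fibers differ in size and there are none. The induction sorts them by the
    image [k] of [ord0]. *)
Lemma count_reindexings (J : finType) (n : nat) (f g : 'I_n -> J) :
  (\sum_(s : 'S_n) [forall i, f (s i) == g i] =
   [forall j, fiber_card f j == fiber_card g j] * \prod_j (fiber_card f j)`!)%N.
Proof.
elim: n f g => [|n IHn] f g.
  rewrite (_ : [forall j, _]); last by apply/forallP => j; rewrite /fiber_card !big_ord0.
  rewrite mul1n [RHS]big1 => [|j _]; last by rewrite /fiber_card !big_ord0.
  rewrite (eq_bigr (fun=> 1%N)) ?sum1_card ?card_Sn // => s _.
  by rewrite (_ : [forall i, _]) //; apply/forallP => -[].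
rewrite (reindex (fun p : 'I_n.+1 * 'S_n => lift_perm ord0 p.1 p.2)) /=; last first.
  exact/onW_bij/lift_perm_bij.
pose g0 := g ord0.
have step k s : [forall i, f (lift_perm ord0 k s i) == g i] =
    (f k == g0) && [forall i, (f \o lift k) (s i) == (g \o lift ord0) i].
  apply/forallP/andP => [fg|[fk /forallP fg] i].
    split; first by have := fg ord0; rewrite lift_perm_id.
    by apply/forallP => i; have := fg (lift ord0 i); rewrite lift_perm_lift.
  case: (unliftP ord0 i) => [i'|] ->; last by rewrite lift_perm_id.
  by rewrite lift_perm_lift; apply: fg.
rewrite -(pair_bigA _ (fun k s => nat_of_bool [forall i, f (lift_perm ord0 k s i) == g i])) /=.
(* Once [ord0] goes to a [k] with [f k = g0], both functions lose one point over [g0], hence the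
   predecessor under the factorial. *)
have inner k : (\sum_s [forall i, f (lift_perm ord0 k s i) == g i] =
    (f k == g0) * ([forall j, fiber_card f j == fiber_card g j] *
      ((fiber_card f g0).-1`! * \prod_(j | j != g0) (fiber_card f j)`!)))%N.
  under eq_bigr do rewrite step -mulnb.
  rewrite -big_distrr /= (IHn (f \o lift k) (g \o lift ord0)).
  have [fk|] := eqVneq (f k) g0; last by rewrite !mul0n.
  rewrite !mul1n; congr (nat_of_bool _ * _)%N.
    apply: eq_forallb => j.
    by rewrite (fiber_cardS f k) (fiber_cardS g ord0) fk eqn_add2l.
  rewrite (bigD1 g0) //=; congr (_ * _)%N.
    by rewrite (fiber_cardS f k) fk eqxx.
  by apply: eq_bigr => j j_g0; rewrite (fiber_cardS f k) fk eq_sym (negbTE j_g0).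
rewrite (eq_bigr _ (fun k _ => inner k)) -big_distrl /= mulnCA.
have [/forallP fg|] := boolP [forall j, fiber_card f j == fiber_card g j]; last by [].
(* There are [fiber_card f g0] admissible [k], a positive number because [g] takes the value [g0];
   this restores the full factorial. *)
rewrite !mul1n [RHS](bigD1 g0) //= mulnA -/(fiber_card f g0); congr (_ * _)%N.
rewrite (eqP (fg g0)) (fiber_cardS g ord0 g0) eqxx add1n factS; congr (_ * _)%N.
Qed.

Lemma fiber_card_le (J : finType) (n : nat) (f : 'I_n -> J) (j : J) : (fiber_card f j <= n)%N.
Proof.
rewrite -[leqRHS]card_ord -sum1_card; apply: leq_sum => i _; exact: leq_b1.
Qed.

Lemma prod_fibers (C : comNzRingType) (J : finType) (n : nat) (f : 'I_n -> J)
    (x : J -> C) :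
  \prod_i x (f i) = \prod_j x j ^+ fiber_card f j.
Proof.
rewrite (partition_big f predT) //=; apply: eq_bigr => j _.
rewrite (eq_bigr (fun=> x j)) => [|i /eqP -> //].
rewrite prodr_const /fiber_card -sum1_card [in LHS]big_mkcond /=.
by congr (_ ^+ _); apply: eq_bigr => i _; rewrite unfold_in; case: eqP.
Qed.

Lemma fiber_card_perm (J : finType) (n : nat) (f : 'I_n -> J) (s : 'S_n) (j : J) :
  fiber_card (fun i => f (s i)) j = fiber_card f j.
Proof. by rewrite /fiber_card [RHS](reindex_inj (@perm_inj _ s)). Qed.

(** The nonnegative sum of all [|x i - x j|^2] expands to twice the difference of the two sides. *)
Lemma normC_sum_sq (C : numClosedFieldType) (I : finType) (x : I -> C) :
  `|\sum_i x i| ^+ 2 <= #|I|%:R * \sum_i `|x i| ^+ 2.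
Proof.
have : 0 <= \sum_i \sum_j `|x i - x j| ^+ 2.
  by apply: sumr_ge0 => i _; apply: sumr_ge0 => j _; rewrite exprn_ge0.
have -> : \sum_i \sum_j `|x i - x j| ^+ 2 =
    \sum_i \sum_j (`|x i| ^+ 2 + `|x j| ^+ 2 - (x i * (x j)^* + x j * (x i)^* )).
  apply: eq_bigr => i _; apply: eq_bigr => j _.
  by rewrite !normCK rmorphB /= mulrBl !mulrBr; ring.
have row i : \sum_j (`|x i| ^+ 2 + `|x j| ^+ 2 - (x i * (x j)^* + x j * (x i)^* )) =
    #|I|%:R * `|x i| ^+ 2 + \sum_j `|x j| ^+ 2 -
    (x i * (\sum_j x j)^* + (\sum_j x j) * (x i)^* ).
  rewrite sumrB !big_split /= sumr_const mulr_natl.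
  by rewrite (rmorph_sum (@Num.conj C)) mulr_sumr mulr_suml.
rewrite (eq_bigr _ (fun i _ => row i)) sumrB !big_split /= sumr_const.
rewrite -mulr_sumr -mulr_suml -mulr_sumr -(rmorph_sum (@Num.conj C)) -normCK.
by rewrite -[X in _ + X - _]mulr_natl subr_ge0 -!mulr2n ler_pMn2r.
Qed.

(** * Moments of a product design *)

Section ProductDesign.
Variables (C : numClosedFieldType) (D J : finType) (w zeta : D -> C) (n : nat).
Variable mu : nat -> C.
Hypothesis momentE : forall a b, (a <= n)%N -> (b <= n)%N ->
  \sum_d w d * ((zeta d)^* ^+ a * zeta d ^+ b) = (a == b)%:R * mu a.

Definition prod_weight (om : {ffun J -> D}) : C := \prod_j w (om j).
Definition prod_point (om : {ffun J -> D}) (j : J) : C := zeta (om j).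
(** Compares the design with standard complex Gaussian coordinates, for which [mu a = a!] and the
    ratio is 1. *)
Definition prod_ratio (f : 'I_n -> J) : C :=
  \prod_j (mu (fiber_card f j) / (fiber_card f j)`!%:R).

(** Wick's formula for the design: by independence the moment factors over [J], a factor vanishes
    unless the exponents of [f] and [g] agree, and the factorials count the pairings. *)
Lemma prod_design_moment (f g : 'I_n -> J) :
  \sum_(om : {ffun J -> D}) prod_weight om *
     (\prod_i (prod_point om (f i))^* * \prod_i prod_point om (g i)) =
  prod_ratio f * (\sum_(s : 'S_n) [forall i, f (s i) == g i])%:R.
Proof.
transitivity (\sum_(om : {ffun J -> D}) \prod_j (w (om j) *
   ((zeta (om j))^* ^+ fiber_card f j * zeta (om j) ^+ fiber_card g j))).
  apply: eq_bigr => om _; rewrite !big_split /=; congr (_ * (_ * _)).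
    exact: (prod_fibers f (fun j => (prod_point om j)^* )).
  exact: prod_fibers.
rewrite -(bigA_distr_bigA (fun j d =>
  w d * ((zeta d)^* ^+ fiber_card f j * zeta d ^+ fiber_card g j))).
rewrite count_reindexings natrM mulrCA natr_prod -big_split /=.
rewrite (eq_bigr (fun j =>
  (fiber_card f j == fiber_card g j)%:R * mu (fiber_card f j))); last first.
  by move=> j _; rewrite momentE ?fiber_card_le.
rewrite big_split /=; congr (_ * _).
  have [/forallP fg|/forallPn[j fg]] := boolP [forall j, fiber_card f j == fiber_card g j].
    by rewrite big1 // => j _; rewrite fg.
  by rewrite (bigD1 j) //= (negbTE fg) mul0r.
by apply: eq_bigr => j _; rewrite divfK // pnatr_eq0 -lt0n fact_gt0.
Qed.

Definition ffperm (f : {ffun 'I_n -> J}) (s : 'S_n) : {ffun 'I_n -> J} :=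
  [ffun i => f (s i)].

Lemma ffpermK s : cancel (ffperm^~ s) (ffperm^~ s^-1%g).
Proof. by move=> f; apply/ffunP => i; rewrite !ffunE permKV. Qed.

Lemma ffperm_bij s : bijective (ffperm^~ s).
Proof.
exists (ffperm^~ s^-1%g); first exact: ffpermK.
by move=> f; have := ffpermK s^-1%g f; rewrite invgK.
Qed.

Lemma ffpermM f s t : ffperm (ffperm f s) t = ffperm f (t * s)%g.
Proof. by apply/ffunP => i; rewrite !ffunE permM. Qed.

(** Not normalized: this is [n!] times the projection onto symmetric tensors, which explains the
    factorials below. *)
Definition symmetrize (F : {ffun 'I_n -> J} -> C) (f : {ffun 'I_n -> J}) : C :=
  \sum_(s : 'S_n) F (ffperm f s).

Lemma symmetrize_perm F f t : symmetrize F (ffperm f t) = symmetrize F f.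
Proof.
rewrite /symmetrize [RHS](reindex_inj (mulIg t)) /=.
by apply: eq_bigr => s _; rewrite ffpermM.
Qed.

(** Relabelling [f] by a permutation changes neither [G] nor [symmetrize F], so the lone [F] may be
    averaged over all permutations. *)
Lemma sum_symmetrize F (G : {ffun 'I_n -> J} -> C) :
  (forall f s, G (ffperm f s) = G f) ->
  \sum_f G f * F f * (symmetrize F f)^* =
  n`!%:R^-1 * \sum_f G f * `|symmetrize F f| ^+ 2.
Proof.
move=> Gperm; apply: (mulfI (_ : n`!%:R != 0 :> C)).
  by rewrite pnatr_eq0 -lt0n fact_gt0.
rewrite mulrA divff ?mul1r; last by rewrite pnatr_eq0 -lt0n fact_gt0.
transitivity (\sum_(s : 'S_n) \sum_f G f * F f * (symmetrize F f)^* ).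
  by rewrite sumr_const card_Sn mulr_natl.
transitivity (\sum_(s : 'S_n) \sum_f G f * F (ffperm f s) * (symmetrize F f)^* ).
  apply: eq_bigr => s _; rewrite (reindex _ (onW_bij _ (ffperm_bij s))) /=.
  by apply: eq_bigr => f _; rewrite Gperm symmetrize_perm.
rewrite exchange_big /=; apply: eq_bigr => f _.
by rewrite -mulr_suml -mulr_sumr -mulrA -normCK.
Qed.

(** The inner product of the coherent tensor [z^(x)n] with the tensor of coefficients [F]. *)
Definition prod_form (F : {ffun 'I_n -> J} -> C) (om : {ffun J -> D}) : C :=
  \sum_f F f * \prod_i (prod_point om (f i))^*.

(* The ratio is permutation invariant, so it factors out of the sum over the
   reindexings and multiplies the square of the symmetrized coefficients. *)
Lemma prod_design_norm F :
  \sum_(om : {ffun J -> D}) prod_weight om * `|prod_form F om| ^+ 2 =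
  n`!%:R^-1 * \sum_(f : {ffun 'I_n -> J}) prod_ratio f * `|symmetrize F f| ^+ 2.
Proof.
rewrite -sum_symmetrize; last first.
  move=> f s; apply: eq_bigr => j _.
  rewrite (_ : fiber_card (ffperm f s) j = fiber_card f j) // -[RHS](fiber_card_perm _ s).
  by apply: eq_bigr => i _; rewrite ffunE.
transitivity (\sum_f \sum_g F f * (F g)^* *
   (prod_ratio f * (\sum_(s : 'S_n) [forall i, f (s i) == g i])%:R)).
  under eq_bigr => om _.
    rewrite normCK (rmorph_sum (@Num.conj C)) big_distrlr mulr_sumr.
    under eq_bigr => f _ do rewrite mulr_sumr.
    over.
  rewrite exchange_big; apply: eq_bigr => f _ /=.
  rewrite exchange_big; apply: eq_bigr => g _ /=.
  rewrite -prod_design_moment mulr_sumr; apply: eq_bigr => om _.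
  rewrite rmorphM rmorph_prod /=.
  under [X in _ * (_ * (_ * X))]eq_bigr do rewrite conjCK.
  ring.
apply: eq_bigr => f _; rewrite (rmorph_sum (@Num.conj C)) mulr_sumr.
transitivity (\sum_g \sum_(s : 'S_n) prod_ratio f * F f *
     ((F g)^* * [forall i, f (s i) == g i]%:R)).
  apply: eq_bigr => g _; rewrite natr_sum !mulr_sumr; apply: eq_bigr => s _; ring.
rewrite exchange_big; apply: eq_bigr => s _ /=; rewrite -mulr_sumr; congr (_ * _).
rewrite (bigD1 (ffperm f s)) //= big1 => [|g /eqP g_fs].
  rewrite addr0 (_ : [forall i, _]) ?mulr1 //.
  by apply/forallP => i; rewrite ffunE.
have [/forallP E|] := boolP [forall i, f (s i) == g i]; last by rewrite mulr0.
by case: g_fs; apply/ffunP => i; rewrite ffunE (eqP (E i)).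
Qed.

Hypothesis ratio_le1 : forall f : {ffun 'I_n -> J}, prod_ratio f <= 1.

(** The bound keeps one unsymmetrized factor because for a product tensor this form is the permanent
    of a Gram matrix. *)
Lemma prod_design_le F :
  \sum_(om : {ffun J -> D}) prod_weight om * `|prod_form F om| ^+ 2 <=
  \sum_f F f * (symmetrize F f)^*.
Proof.
under [leRHS]eq_bigr do rewrite -[F _]mul1r.
rewrite prod_design_norm (@sum_symmetrize _ (fun=> 1)) // ler_wpM2l ?invr_ge0 ?ler0n //.
by apply: ler_sum => f _; rewrite ler_wpM2r // exprn_ge0.
Qed.

(** After division by [n!] this says that the effects sum to at most 1. It follows from
    Cauchy-Schwarz over the [n!] permutations. *)
Lemma prod_design_bessel F :
  \sum_(om : {ffun J -> D}) prod_weight om * `|prod_form F om| ^+ 2 <=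
  n`!%:R * \sum_f `|F f| ^+ 2.
Proof.
apply: le_trans (prod_design_le F) _.
under eq_bigr do rewrite -[F _]mul1r.
rewrite (@sum_symmetrize _ (fun=> 1)) // -ler_pdivlMl; last first.
  by rewrite invr_gt0 ltr0n fact_gt0.
rewrite invrK.
apply: (@le_trans _ _ (\sum_f n`!%:R * \sum_(s : 'S_n) `|F (ffperm f s)| ^+ 2)).
  apply: ler_sum => f _; rewrite mul1r.
  by apply: le_trans (normC_sum_sq _) _; rewrite card_Sn.
rewrite -mulr_sumr ler_wpM2l ?ler0n // exchange_big /=.
rewrite (eq_bigr (fun=> \sum_f `|F f| ^+ 2)) => [|s _].
  by rewrite sumr_const card_Sn mulr_natl.
by rewrite [RHS](reindex _ (onW_bij _ (ffperm_bij s))).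
Qed.

End ProductDesign.

(* A permutation fixing 0 contributes [<y,y> vv^m], any other one contributes
   [|<v,y>|^2 vv^(m-1)]. *)
Section PermanentBound.
Variables (C : numClosedFieldType) (m : nat) (J : finType) (v y : J -> C).
Let u (i : 'I_m.+1) : J -> C := if i == ord0 then y else v.
Let gram (i k : 'I_m.+1) : C := \sum_j u i j * (u k j)^*.
Let vv : C := \sum_j `|v j| ^+ 2.
Let vy : C := \sum_j v j * (y j)^*.

Lemma permanent_gram_le : vv <= 1 ->
  \sum_(s : 'S_m.+1) \prod_i gram i (s i) <=
  m`!%:R * (\sum_j `|y j| ^+ 2 + m%:R * `|vy| ^+ 2).
Proof.
move=> vv_le1; have vv_ge0 : 0 <= vv by apply: sumr_ge0 => j _; rewrite exprn_ge0.
have gram0 i k : i != ord0 -> k != ord0 -> gram i k = vv.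
  move=> i0 k0; apply: eq_bigr => j _.
  by rewrite /u (negbTE i0) (negbTE k0) normCK.
have gram1 i : i != ord0 -> gram i ord0 = vy.
  by move=> i0; apply: eq_bigr => j _; rewrite /u (negbTE i0).
have gram2 i : i != ord0 -> gram ord0 i = vy^*.
  move=> i0; rewrite rmorph_sum /=; apply: eq_bigr => j _.
  by rewrite /u (negbTE i0) /= rmorphM /= conjCK mulrC.
rewrite (reindex (fun p : 'I_m.+1 * 'S_m => lift_perm ord0 p.1 p.2)) /=; last first.
  exact/onW_bij/lift_perm_bij.
rewrite -(pair_bigA _ (fun k s => \prod_i gram i (lift_perm ord0 k s i))) /=.
rewrite big_ord_recl mulrDr /=; apply: lerD.
  rewrite mulr_natl -(card_Sn m) -sumr_const; apply: ler_sum => s _.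
  rewrite big_ord_recl lift_perm_id.
  rewrite (_ : gram ord0 ord0 = \sum_j `|y j| ^+ 2); last first.
    by apply: eq_bigr => j _; rewrite normCK.
  rewrite ler_piMr //; first by apply: sumr_ge0 => j _; rewrite exprn_ge0.
  apply: prodr_ile1 => i _ /=; rewrite lift_perm_lift gram0 ?vv_ge0 //.
rewrite mulrCA -[X in X%:R * (_ * _)](card_ord m) mulr_natl -sumr_const.
apply: ler_sum => k _.
rewrite mulr_natl -(card_Sn m) -sumr_const; apply: ler_sum => s _.
rewrite big_ord_recl lift_perm_id gram2 //.
(* Column [ord0] is taken by the row [lift ord0 (s^-1 l)]. Its entry [vy] and the conjugate entry of
   row [ord0] form [|vy|^2]; the other entries are [vv <= 1]. *)
have [l l0] : exists l, lift (lift ord0 k) l = ord0.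
  by case: (unliftP (lift ord0 k) ord0) => // l; exists l.
rewrite (bigD1 (s^-1%g l)) //= lift_perm_lift permKV l0 gram1 //.
rewrite mulrA [vy^* * _]mulrC -normCK ler_piMr ?exprn_ge0 //.
apply: prodr_ile1 => i i_l; rewrite lift_perm_lift gram0 ?vv_ge0 //.
rewrite -[X in _ != X]l0 (inj_eq lift_inj); apply: contraNneq i_l => <-.
by rewrite permK.
Qed.

End PermanentBound.

(** * Overlaps of product vectors with coherent vectors *)

Section CoherentStates.
Variables (C : numClosedFieldType) (D J : finType) (w zeta : D -> C) (n : nat).
Variable mu : nat -> C.
Hypothesis momentE : forall a b, (a <= n)%N -> (b <= n)%N ->
  \sum_d w d * ((zeta d)^* ^+ a * zeta d ^+ b) = (a == b)%:R * mu a.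
Local Notation weight := (@prod_weight C D J w).
Local Notation point := (@prod_point C D J zeta).

Definition overlap (psi : J -> C) (om : {ffun J -> D}) : C :=
  \sum_j (point om j)^* * psi j.

Lemma prod_form_prod (u : 'I_n -> J -> C) om :
  prod_form zeta (fun f => \prod_i u i (f i)) om = \prod_i overlap (u i) om.
Proof.
rewrite bigA_distr_bigA; apply: eq_bigr => f _.
by rewrite -big_split; apply: eq_bigr => i _; rewrite mulrC.
Qed.

Lemma sum_normM (u : 'I_n -> J -> C) :
  \sum_(f : {ffun 'I_n -> J}) `|\prod_i u i (f i)| ^+ 2 =
  \prod_i \sum_j `|u i j| ^+ 2.
Proof.
rewrite bigA_distr_bigA; apply: eq_bigr => f _.
by rewrite normr_prod -prodrXl.
Qed.

(** The tensor power of [psi] is already symmetric, so only the ratio can lose mass. This bounds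
    from below the probability of avoiding the remainder outcome. *)
Lemma overlap_moment_ge (psi : J -> C) (eps : C) :
  (forall f : {ffun 'I_n -> J}, 1 - eps <= prod_ratio mu f) ->
  (1 - eps) * n`!%:R * (\sum_j `|psi j| ^+ 2) ^+ n <=
  \sum_(om : {ffun J -> D}) weight om * `|overlap psi om| ^+ (2 * n).
Proof.
move=> eps_le; pose F (f : {ffun 'I_n -> J}) := \prod_i psi (f i).
have symF f : symmetrize F f = n`!%:R * F f.
  rewrite /symmetrize (eq_bigr (fun=> F f)) ?sumr_const ?card_Sn ?mulr_natl //.
  move=> s _; rewrite /F [RHS](reindex_inj (@perm_inj _ s)).
  by apply: eq_bigr => i _; rewrite ffunE.
have -> : \sum_(om : {ffun J -> D}) weight om * `|overlap psi om| ^+ (2 * n) =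
    \sum_(om : {ffun J -> D}) weight om * `|prod_form zeta F om| ^+ 2.
  apply: eq_bigr => om _; rewrite (prod_form_prod (fun=> psi)) prodr_const card_ord.
  by rewrite normrX -exprM mulnC.
rewrite (prod_design_norm momentE) -[n in _ ^+ n]card_ord -prodr_const.
rewrite -(sum_normM (fun=> psi)) mulr_sumr [leRHS]mulr_sumr.
apply: ler_sum => f _; rewrite symF normrM normr_nat.
have K0 : 0 < n`!%:R :> C by rewrite ltr0n fact_gt0.
rewrite (_ : n`!%:R^-1 * _ = n`!%:R * `|F f| ^+ 2 * prod_ratio mu f); last first.
  by field; rewrite gt_eqF.
by rewrite -mulrA mulrC ler_wpM2l // mulr_ge0 ?(ltW K0) // exprn_ge0.
Qed.

End CoherentStates.

Section CoherentError.
Variables (C : numClosedFieldType) (D J : finType) (w zeta : D -> C) (m : nat).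
Variable mu : nat -> C.
Hypothesis momentE : forall a b, (a <= m.+1)%N -> (b <= m.+1)%N ->
  \sum_d w d * ((zeta d)^* ^+ a * zeta d ^+ b) = (a == b)%:R * mu a.
Hypothesis ratio_le1 : forall f : {ffun 'I_m.+1 -> J}, prod_ratio mu f <= 1.
Local Notation weight := (@prod_weight C D J w).
Local Notation point := (@prod_point C D J zeta).

(** The integrand is the squared overlap with the product of one [y] and [m] copies of [psi], so the
    permanent bound applies. *)
Lemma overlap_pow_moment_le (psi y : J -> C) : \sum_j `|psi j| ^+ 2 <= 1 ->
  \sum_(om : {ffun J -> D}) weight om *
     (`|overlap zeta psi om| ^+ (2 * m) * `|overlap zeta y om| ^+ 2) <=
  m`!%:R * (\sum_j `|y j| ^+ 2 + m%:R * `|\sum_j psi j * (y j)^* | ^+ 2).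
Proof.
move=> psi_le1; pose u (i : 'I_m.+1) := if i == ord0 then y else psi.
pose F (f : {ffun 'I_m.+1 -> J}) := \prod_i u i (f i).
apply: le_trans (permanent_gram_le m y psi_le1).
have -> : \sum_(om : {ffun J -> D}) weight om *
     (`|overlap zeta psi om| ^+ (2 * m) * `|overlap zeta y om| ^+ 2) =
   \sum_(om : {ffun J -> D}) weight om * `|prod_form zeta F om| ^+ 2.
  apply: eq_bigr => om _; rewrite prod_form_prod big_ord_recl /u eqxx /=.
  rewrite prodr_const card_ord normrM normrX exprMn -exprM [(m * 2)%N]mulnC.
  by congr (_ * _); rewrite mulrC.
apply: le_trans (prod_design_le momentE ratio_le1 F) _; rewrite le_eqVlt; apply/predU1P; left.
transitivity (\sum_(s : 'S_m.+1) \sum_(f : {ffun 'I_m.+1 -> J})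
    \prod_i (u i (f i) * (u (s i) (f i))^* )).
  rewrite [RHS](reindex_inj invg_inj) exchange_big; apply: eq_bigr => f _.
  rewrite (rmorph_sum (@Num.conj C)) mulr_sumr; apply: eq_bigr => s _ /=.
  rewrite big_split rmorph_prod /=; congr (_ * _).
  rewrite [RHS](reindex_inj (@perm_inj _ s)) /=.
  by apply: eq_bigr => i _; rewrite permK ffunE.
by apply: eq_bigr => s _; rewrite bigA_distr_bigA.
Qed.

(** Each coordinate of the error is, up to conjugation, the overlap with a fixed vector [y j]. The
    previous bound therefore applies coordinate by coordinate, and the sum over [j] is taken
    afterwards. *)
Lemma coherent_error_le (psi : J -> C) (A : {set J}) :
  \sum_j `|psi j| ^+ 2 <= 1 ->
  \sum_(om : {ffun J -> D}) weight om * (`|overlap zeta psi om| ^+ (2 * m) *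
     \sum_j `|(overlap zeta psi om)^* * psi j - (j \in A)%:R * point om j| ^+ 2) <=
  m.+1`!%:R * ((1 + #|A|%:R) / m.+1%:R + (1 - \sum_(j in A) `|psi j| ^+ 2)).
Proof.
move=> psi_le1; set q' := \sum_j `|psi j| ^+ 2 in psi_le1 *.
set q := \sum_(j in A) `|psi j| ^+ 2.
pose a (j : J) : C := (j \in A)%:R.
have aN j : (a j)^* = a j by rewrite /a; case: (j \in A); rewrite ?rmorph1 ?rmorph0.
have qE : q = \sum_j a j * `|psi j| ^+ 2.
  rewrite /q big_mkcond; apply: eq_bigr => j _; rewrite /a.
  by case: ifP; rewrite ?mul1r ?mul0r.
have q'_ge0 : 0 <= q' by apply: sumr_ge0 => j _; rewrite exprn_ge0.
have q'C : q'^* = q' by apply: conj_Creal; apply: ger0_real.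
have q_ge0 : 0 <= q by apply: sumr_ge0 => j _; rewrite exprn_ge0.
have qq' : q <= q'.
  rewrite qE; apply: ler_sum => j _; rewrite /a.
  by case: (j \in A); rewrite ?mul1r ?mul0r ?exprn_ge0.
pose y j k := psi k * (psi j)^* - a j * (k == j)%:R.
have overlap_y j om : overlap zeta (y j) om =
   ((overlap zeta psi om)^* * psi j - a j * point om j)^*.
  rewrite rmorphB !rmorphM /= conjCK aN /overlap mulr_suml.
  rewrite (eq_bigr (fun k => (point om k)^* * psi k * (psi j)^* -
     a j * ((k == j)%:R * (point om k)^* ))) => [|k _]; last by rewrite /y; ring.
  rewrite sumrB -mulr_sumr; congr (_ - _ * _).
  rewrite (bigD1 j) //= eqxx mul1r big1 ?addr0 // => k /negbTE ->.
  by rewrite mul0r.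
have delta j c : \sum_k (k == j)%:R * c = c :> C.
  by rewrite (bigD1 j) //= eqxx mul1r big1 ?addr0 // => k /negbTE ->; rewrite mul0r.
have y_norm j : \sum_k `|y j k| ^+ 2 = (q' - 2 * a j) * `|psi j| ^+ 2 + a j.
  rewrite (eq_bigr (fun k => `|psi j| ^+ 2 * `|psi k| ^+ 2 +
     (k == j)%:R * (a j - 2 * a j * `|psi j| ^+ 2))) => [|k _].
    by rewrite big_split /= -mulr_sumr delta -/q'; ring.
  rewrite /y !normCK rmorphB !rmorphM /= conjCK aN.
  have aa : a j * a j = a j by rewrite /a; case: (j \in A); rewrite ?mul1r ?mul0r.
  have [->|_] := eqVneq k j; rewrite ?rmorph1 ?rmorph0; last by ring.
  by rewrite -[X in _ = _ + _ * (X - _)]aa; ring.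
have y_psi j : \sum_k psi k * (y j k)^* = psi j * (q' - a j).
  rewrite (eq_bigr (fun k => psi j * `|psi k| ^+ 2 -
     (k == j)%:R * (a j * psi j))) => [|k _].
    by rewrite sumrB -mulr_sumr delta -/q'; ring.
  rewrite /y !normCK rmorphB !rmorphM /= conjCK aN.
  by have [->|_] := eqVneq k j; rewrite ?rmorph1 ?rmorph0; ring.
apply: (@le_trans _ _ (\sum_j m`!%:R * ((q' - 2 * a j) * `|psi j| ^+ 2 + a j +
    m%:R * `|psi j * (q' - a j)| ^+ 2))).
  under eq_bigr do rewrite !mulr_sumr.
  rewrite exchange_big; apply: ler_sum => j _ /=.
  have := overlap_pow_moment_le (y j) psi_le1.
  rewrite y_norm y_psi; congr (_ <= _); apply: eq_bigr => om _.
  by rewrite overlap_y norm_conjC.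
rewrite -mulr_sumr factS natrM [m.+1%:R * _]mulrC -[leRHS]mulrA ler_wpM2l ?ler0n //.
rewrite [leRHS]mulrC mulrDl [X in _ <= X + _]divfK ?pnatr_eq0 // big_split /=; apply: lerD.
  rewrite big_split /= lerD //.
    apply: (@le_trans _ _ (\sum_j `|psi j| ^+ 2)) => //; apply: ler_sum => j _.
    rewrite ler_piMl ?exprn_ge0 //; apply: le_trans psi_le1.
    by rewrite gerBl mulr_ge0 ?ler0n.
  by rewrite /a -natr_sum -big_mkcond sum1_card.
rewrite -mulr_sumr mulrC.
apply: (@le_trans _ _ ((\sum_j `|psi j * (q' - a j)| ^+ 2) * m.+1%:R)).
  rewrite ler_wpM2l ?ler_nat //; apply: sumr_ge0 => j _; exact: exprn_ge0.
rewrite ler_wpM2r ?ler0n //.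
(* Outside [A] the factor is [q'^2 <= 1]; inside it is [(1 - q')^2 <= 1 - q']. The total [q' - q q']
   falls short of [1 - q] by [(1 - q) (1 - q')]. *)
apply: (@le_trans _ _ (\sum_j (`|psi j| ^+ 2 - a j * `|psi j| ^+ 2 * q'))).
  apply: ler_sum => j _; rewrite normrM exprMn /a.
  case: (j \in A); last first.
    rewrite subr0 !mul0r subr0 ler_piMr ?exprn_ge0 // ger0_norm //.
    by rewrite exprn_ile1.
  rewrite mul1r -[X in _ <= X - _]mulr1 -mulrBr ler_wpM2l ?exprn_ge0 //.
  rewrite distrC ger0_norm ?subr_ge0 // expr2 ler_piMr ?subr_ge0 //.
  by rewrite gerBl.
rewrite sumrB -mulr_suml -qE -/q' -subr_ge0.
rewrite (_ : _ - _ = (1 - q) * (1 - q')); last by ring.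
by rewrite mulr_ge0 // subr_ge0 // (le_trans qq').
Qed.

End CoherentError.

(** * A finite design approximating the Gaussian moments *)

Section RadialDesign.
Variables (R : realType) (c : R).
Hypotheses (c_ge0 : 0 <= c) (c_lt1 : c < 1).

(** These are partial sums of the binomial series of [1 / (1 - c)^(a + 1)]. Pascal's rule bounds the
    sum at [a.+1] by the one at [a] plus [c] times itself, so each factor [1 - c] lowers [a] by
    one. *)
Lemma rising_geometric_le (a M : nat) :
  (1 - c) ^+ a.+1 * \sum_(0 <= k < M) 'C(k + a, a)%:R * c ^+ k <= 1.
Proof.
have c1 : 0 <= 1 - c by rewrite subr_ge0 ltW.
elim: a => [|a IHa].
  rewrite expr1 (eq_bigr (fun k => c ^+ k)) => [|k _]; last by rewrite bin0 mul1r.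
  by rewrite big_mkord -opprB mulNr -subrX1 opprB gerBl exprn_ge0.
apply: le_trans IHa; rewrite exprSr -mulrA ler_wpM2l ?exprn_ge0 //.
case: M => [|M]; first by rewrite !big_geq // mulr0.
set U := \sum_(0 <= k < M.+1) 'C(k + a.+1, a.+1)%:R * c ^+ k.
set V := \sum_(0 <= k < M.+1) 'C(k + a, a)%:R * c ^+ k.
have : U <= V + c * U.
  rewrite {1}/U (eq_bigr (fun k => 'C(k + a, a.+1)%:R * c ^+ k +
    'C(k + a, a)%:R * c ^+ k)) => [|k _]; last first.
    by rewrite addnS binS natrD mulrDl.
  rewrite big_split /= addrC lerD2l big_nat_recl // bin_small // mul0r add0r.
  rewrite /U big_nat_recr //= mulrDr mulr_sumr.
  rewrite (eq_bigr (fun k => c * ('C(k + a.+1, a.+1)%:R * c ^+ k))); last first.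
    by move=> k _; rewrite addnS exprS mulrCA.
  by rewrite lerDl !mulr_ge0 ?exprn_ge0.
by rewrite mulrBl mul1r lerBlDr.
Qed.

(* Pascal's rule gives [S (b+1) (M+1) = c S b M + c S (b+1) M] for the partial sums,
   which determines the limits by induction. *)
Lemma falling_geometric_cvg (a : nat) :
  (fun M => (1 - c) ^+ a.+1 * \sum_(0 <= k < M) 'C(k, a)%:R * c ^+ k) @ \oo --> c ^+ a.
Proof.
have c1 : 0 < 1 - c by rewrite subr_gt0.
pose S a M := \sum_(0 <= k < M) 'C(k, a)%:R * c ^+ k.
have cvgS b : cvgn (S b).
  apply: nondecreasing_is_cvgn.
    apply/nondecreasing_seqP => M; rewrite /S big_nat_recr //= lerDl.
    by rewrite mulr_ge0 ?exprn_ge0.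
  exists ((1 - c) ^+ b.+1)^-1 => _ [M _ <-].
  rewrite -[leRHS]mulr1 -ler_pdivrMl ?invr_gt0 ?exprn_gt0 // invrK.
  apply: le_trans (rising_geometric_le b M); rewrite ler_wpM2l ?exprn_ge0 ?(ltW c1) //.
  apply: ler_sum => k _; rewrite ler_wpM2r ?exprn_ge0 // ler_nat.
  by rewrite leq_bin2l ?leq_addr.
have limS : limn (S a) = c ^+ a / (1 - c) ^+ a.+1.
  elim: a => [|b IHb].
    apply/cvg_lim => //; rewrite expr0 expr1.
    have := @cvg_geometric_series R 1 c; rewrite ger0_norm // => /(_ c_lt1).
    apply: cvg_trans; apply: near_eq_cvg; near=> M.
    by rewrite /S /series /=; apply: eq_bigr => k _; rewrite bin0.
  have : limn (S b.+1) = c * limn (S b) + c * limn (S b.+1).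
    have E : (fun M => S b.+1 M.+1) = (fun M => c * S b M + c * S b.+1 M).
      apply/funext => M; rewrite /S big_nat_recl // mul0r add0r !mulr_sumr -big_split.
      by apply: eq_bigr => k _ /=; rewrite binS natrD exprS; ring.
    have : (fun M => S b.+1 M.+1) @ \oo --> limn (S b.+1).
      by have := cvgS b.+1; rewrite -cvg_shiftS.
    rewrite E => /cvg_lim lim_eq; rewrite -[LHS]lim_eq //; apply/cvg_lim => //.
    by apply: cvgD; apply: cvgMl_tmp; apply: cvgS.
  rewrite IHb => E; have -> : limn (S b.+1) = c * (c ^+ b / (1 - c) ^+ b.+1) / (1 - c).
    by apply: (mulIf (lt0r_neq0 c1)); rewrite divfK ?lt0r_neq0 //; lra.
  rewrite [c ^+ b.+1]exprS [_ ^+ b.+2]exprS invfM; ring.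
have -> : c ^+ a = (1 - c) ^+ a.+1 * limn (S a).
  by rewrite limS mulrC divfK // lt0r_neq0 // exprn_gt0.
by apply: cvgMl_tmp; apply: cvgS.
Unshelve. all: by end_near.
Qed.

End RadialDesign.

Lemma bernoulli_le (R : realDomainType) (x : R) (n : nat) : 0 <= x <= 1 ->
  1 - n%:R * x <= (1 - x) ^+ n.
Proof.
move=> /andP[x0 x1]; elim: n => [|n IHn]; first by rewrite mul0r subr0.
rewrite exprS; apply: le_trans (_ : (1 - x) * (1 - n%:R * x) <= _).
  rewrite -natr1; have : 0 <= n%:R * x ^+ 2 by rewrite mulr_ge0 ?exprn_ge0.
  by lra.
by rewrite ler_wpM2l // subr_ge0.
Qed.

(* The points [(1 - c) k], with weights [(1 - c) c^k] and c close to 1, approximate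
   the exponential law; compare [k^a] with rising and falling factorials. *)
Lemma radial_design (R : realType) (n : nat) (delta : R) : 0 < delta ->
  exists (M : nat) (w t : 'I_M -> R),
    (forall k, 0 <= w k /\ 0 <= t k) /\
    forall a, (a <= n)%N ->
      (1 - delta) * a`!%:R <= \sum_k w k * t k ^+ a <= a`!%:R.
Proof.
(* With [c = 1 - x], Bernoulli gives [c^a >= 1 - delta / 2] for all [a <= n]; the other half of
   [delta] pays for the truncation at [M]. *)
move=> delta_gt0; pose x := Num.min 1 (delta / (2 * n.+1%:R)).
have x_gt0 : 0 < x by rewrite /x lt_min ltr01 divr_gt0 // mulr_gt0.
have x_le1 : x <= 1 by rewrite /x ge_min lexx.
have x_le : n.+1%:R * x <= delta / 2.
  rewrite (_ : delta / 2 = n.+1%:R * (delta / (2 * n.+1%:R))); last by field.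
  by rewrite ler_wpM2l // /x ge_min lexx orbT.
pose c := 1 - x.
have c_ge0 : 0 <= c by rewrite subr_ge0.
have c_lt1 : c < 1 by rewrite gtrBl.
have c1 : 0 <= 1 - c by rewrite /c opprB addrC subrK ltW.
have [M HM] : exists M, forall a : 'I_n.+1,
    1 - delta <= (1 - c) ^+ a.+1 * \sum_(0 <= k < M) 'C(k, a)%:R * c ^+ k.
  suff : \forall M \near \oo, forall a : 'I_n.+1,
    1 - delta <= (1 - c) ^+ a.+1 * \sum_(0 <= k < M) 'C(k, a)%:R * c ^+ k.
    by case=> M _ HM; exists M; apply: HM => /=.
  apply: filter_forall => a.
  have := @falling_geometric_cvg R c c_ge0 c_lt1 a.
  move/cvgrPdist_le => /(_ (delta / 2)); rewrite divr_gt0 // => /(_ isT).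
  apply: filterS => M; rewrite ler_norml => /andP[_].
  have := @bernoulli_le _ x a; rewrite ltW // x_le1 -/c => /(_ isT).
  have : a%:R * x <= n.+1%:R * x by rewrite ler_wpM2r ?(ltW x_gt0) // ler_nat ltnW.
  by lra.
exists M, (fun k => (1 - c) * c ^+ k), (fun k => (1 - c) * k%:R); split.
  by move=> k; rewrite !mulr_ge0 ?exprn_ge0.
move=> a a_n; have -> : \sum_(k < M) (1 - c) * c ^+ k * ((1 - c) * k%:R) ^+ a =
    (1 - c) ^+ a.+1 * \sum_(0 <= k < M) k%:R ^+ a * c ^+ k.
  rewrite big_mkord mulr_sumr; apply: eq_bigr => k _.
  by rewrite exprMn exprS; ring.
apply/andP; split.
  apply: (@le_trans _ _ (((1 - c) ^+ a.+1 *
    \sum_(0 <= k < M) 'C(k, a)%:R * c ^+ k) * a`!%:R)).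
    by rewrite ler_wpM2r // (HM (Ordinal (_ : a < n.+1)%N)).
  rewrite -mulrA ler_wpM2l ?exprn_ge0 // mulr_suml; apply: ler_sum => k _.
  rewrite mulrAC ler_wpM2r ?exprn_ge0 // -natrM bin_ffact -natrX ler_nat.
  elim: a {a_n} => [|a IHa] //; rewrite ffactnSr expnSr.
  by rewrite leq_mul // leq_subr.
apply: (@le_trans _ _ (((1 - c) ^+ a.+1 *
  \sum_(0 <= k < M) 'C(k + a, a)%:R * c ^+ k) * a`!%:R)).
  rewrite -mulrA ler_wpM2l ?exprn_ge0 // mulr_suml; apply: ler_sum => k _.
  rewrite mulrAC ler_wpM2r ?exprn_ge0 // -natrM bin_ffact -natrX ler_nat.
  elim: a {a_n} => [|a IHa] //; rewrite addnS ffactSS expnS.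
  by rewrite leq_mul // leqW // leq_addr.
by rewrite ler_piMl // rising_geometric_le.
Qed.

(** A geometric sum over the powers of [omega^(b - a)]. Using roots of order [n.+1] keeps distinct
    exponents up to [n] distinct modulo the order, so the ratio is 1 only if [a = b]. *)
Lemma prim_root_orthogonality (C : numClosedFieldType) (n a b : nat) (omega : C) :
  n.+1.-primitive_root omega -> (a <= n)%N -> (b <= n)%N ->
  \sum_(p < n.+1) ((omega ^+ p)^* ^+ a * (omega ^+ p) ^+ b) = (a == b)%:R * n.+1%:R.
Proof.
move=> prim a_n b_n; have omega1 : omega^* * omega = 1.
  have /eqP : `|omega| ^+ n.+1 = 1 by rewrite -normrX (prim_expr_order prim) normr1.
  by rewrite pexpr_eq1 // mulrC -normCK => /eqP ->; rewrite expr1n.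
pose x := omega^* ^+ a * omega ^+ b.
rewrite (eq_bigr (fun p : 'I_n.+1 => x ^+ p)) => [|p _]; last first.
  by rewrite rmorphXn /= exprMn -!exprM ![(p * _)%N]mulnC.
have [eq_ab|ne_ab] := eqVneq a b.
  rewrite mul1r (eq_bigr (fun=> 1)) ?sumr_const ?card_ord // => p _.
  by rewrite /x eq_ab -exprMn omega1 !expr1n.
rewrite mul0r; apply: (mulfI (_ : x - 1 != 0)); last first.
  rewrite mulr0 -subrX1 exprMn -!exprM ![(_ * n.+1)%N]mulnC !exprM.
  have -> : omega^* ^+ n.+1 = 1 by rewrite -rmorphXn /= (prim_expr_order prim) rmorph1.
  by rewrite (prim_expr_order prim) !expr1n mulr1 subrr.
rewrite subr_eq0; apply: contra ne_ab => /eqP x1.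
have E : omega ^+ a * x = omega ^+ b.
  by rewrite /x mulrA -exprMn [omega * _]mulrC omega1 expr1n mul1r.
by move: E; rewrite x1 mulr1 => /eqP; rewrite (eq_prim_root_expr prim) !modn_small.
Qed.

Lemma coherent_design (R : realType) (J : finType) (n : nat) (eps : R) : 0 < eps ->
  exists (D : finType) (w zeta : D -> R[i]) (mu : nat -> R[i]),
    [/\ forall d, 0 <= w d,
        forall a b, (a <= n)%N -> (b <= n)%N ->
          \sum_d w d * ((zeta d)^* ^+ a * zeta d ^+ b) = (a == b)%:R * mu a &
        forall f : {ffun 'I_n -> J},
          1 - real_complex R eps <= prod_ratio mu f /\ prod_ratio mu f <= 1].
Proof.
(* Every element of [J] contributes a factor to the ratio, even if [f] misses it, since the total
   weight [mu 0] may be below 1. Hence [eps] is shared among the elements of [J], not among the [n]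
   factors. *)
move=> eps_gt0; pose delta := Num.min 1 (eps / #|J|.+1%:R).
have delta_gt0 : 0 < delta by rewrite lt_min ltr01 divr_gt0.
have delta_le1 : delta <= 1 by rewrite ge_min lexx.
have delta_eps : #|J|%:R * delta <= eps.
  rewrite (_ : eps = #|J|.+1%:R * (eps / #|J|.+1%:R)); last by field.
  rewrite ler_pM ?ler_nat ?(ltW delta_gt0) //.
  by rewrite ge_min lexx orbT.
have [M [w [t [wt_ge0 wt_moment]]]] := radial_design n delta_gt0.
have [omega prim] := prim_root_exists R[i] (ltn0Sn n).
pose r k : R[i] := sqrtC (real_complex R (t k)).
have r_ge0 k : 0 <= r k by rewrite sqrtC_ge0 ler0c; case: (wt_ge0 k).
have rN k : (r k)^* = r k by apply: conj_Creal; apply: ger0_real.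
pose mu a := real_complex R (\sum_k w k * t k ^+ a).
exists ('I_n.+1 * 'I_M)%type, (fun d : 'I_n.+1 * 'I_M => real_complex R (w d.2) / n.+1%:R).
exists (fun d : 'I_n.+1 * 'I_M => omega ^+ d.1 * r d.2), mu; split.
- move=> d; rewrite mulr_ge0 ?invr_ge0 ?ler0n // ler0c.
  by case: (wt_ge0 d.2).
- move=> a b a_n b_n.
  rewrite -(pair_bigA _ (fun (p : 'I_n.+1) k => real_complex R (w k) / n.+1%:R *
     ((omega ^+ p * r k)^* ^+ a * (omega ^+ p * r k) ^+ b))) exchange_big /=.
  rewrite (eq_bigr (fun k => real_complex R (w k) / n.+1%:R * (r k ^+ a * r k ^+ b) *
     ((a == b)%:R * n.+1%:R))) => [|k _]; last first.
    rewrite -(prim_root_orthogonality prim a_n b_n) mulr_sumr; apply: eq_bigr => p _.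
    by rewrite rmorphM /= rN !exprMn; ring.
  have [<-|_] := eqVneq a b; last first.
    by rewrite [RHS]mul0r big1 // => k _; rewrite mul0r mulr0.
  rewrite [RHS]mul1r /mu rmorph_sum; apply: eq_bigr => k _ /=.
  rewrite -exprD addnn -mul2n exprM sqrtCK rmorphM rmorphXn /=.
  by rewrite mul1r mulrAC divfK ?pnatr_eq0.
- move=> f; pose e j := (\sum_k w k * t k ^+ fiber_card f j) / (fiber_card f j)`!%:R.
  have -> : prod_ratio mu f = real_complex R (\prod_j e j).
    rewrite rmorph_prod /=; apply: eq_bigr => j _; rewrite rmorphM fmorphV.
    by rewrite rmorph_nat.
  have e_bounds j : 1 - delta <= e j <= 1.
    rewrite ler_pdivlMr ?ltr0n ?fact_gt0 // ler_pdivrMr ?ltr0n ?fact_gt0 // mul1r.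
    by rewrite wt_moment ?fiber_card_le.
  rewrite -[1]/(real_complex R 1) -rmorphB !lecR; split; last first.
    apply: prodr_ile1 => j _; case/andP: (e_bounds j) => lb ->; rewrite andbT.
    by apply: le_trans lb; rewrite subr_ge0.
  apply: (@le_trans _ _ ((1 - delta) ^+ #|J|)).
    apply: le_trans (bernoulli_le _ _); last by rewrite (ltW delta_gt0).
    by rewrite lerB.
  rewrite -prodr_const; apply: ler_prod => j _.
  by case/andP: (e_bounds j) => -> _; rewrite subr_ge0 delta_le1.
Qed.

(** * Hilbert spaces, traces and square roots *)

Section Braket.
Variables (R : realType) (H : hilbert R).
Implicit Types (u v x y : H) (a : R[i]).

Lemma braketDr u v x : braket u (v + x) = braket u v + braket u x.
Proof. exact: linearDl. Qed.

Lemma braketZr a u v : braket u (a *: v) = a * braket u v.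
Proof. exact: linearZl_LR. Qed.

Lemma braketDl u v x : braket (u + v) x = braket u x + braket v x.
Proof. exact: linearDr. Qed.

Lemma braketZl a u v : braket (a *: u) v = a^* * braket u v.
Proof. exact: linearZr_LR. Qed.

Lemma braketC u v : (braket u v)^* = braket v u.
Proof. by rewrite /braket hermC /= expr0 mul1r conjCK. Qed.

Lemma braket0r u : braket u 0 = 0. Proof. exact: linear0l. Qed.
Lemma braket0l u : braket 0 u = 0. Proof. exact: linear0r. Qed.

Lemma braketNr u v : braket u (- v) = - braket u v.
Proof. by rewrite -scaleN1r braketZr mulN1r. Qed.

Lemma braketBr u v x : braket u (v - x) = braket u v - braket u x.
Proof. by rewrite braketDr braketNr. Qed.

Lemma braketNl u v : braket (- u) v = - braket u v.
Proof. by rewrite -[LHS]braketC braketNr rmorphN /= braketC. Qed.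

Lemma braketBl u v x : braket (u - v) x = braket u x - braket v x.
Proof. by rewrite braketDl braketNl. Qed.

Lemma braket_sumr I (r : seq I) (P : pred I) u (F : I -> H) :
  braket u (\sum_(i <- r | P i) F i) = \sum_(i <- r | P i) braket u (F i).
Proof. by apply: big_morph => [v x|]; rewrite ?braketDr ?braket0r. Qed.

Lemma braket_suml I (r : seq I) (P : pred I) u (F : I -> H) :
  braket (\sum_(i <- r | P i) F i) u = \sum_(i <- r | P i) braket (F i) u.
Proof.
rewrite -[LHS]braketC braket_sumr (rmorph_sum (@Num.conj R[i])).
by apply: eq_bigr => i _; rewrite -[RHS]braketC.
Qed.

Lemma braket_norm x : braket x x = `|x| ^+ 2.
Proof. exact: inner_norm. Qed.

Lemma braket_ge0 x : 0 <= braket x x.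
Proof. by rewrite braket_norm exprn_ge0. Qed.

Lemma braket_eq0 x : braket x x = 0 -> x = 0.
Proof. by rewrite braket_norm => /eqP; rewrite expf_eq0 /= normr_eq0 => /eqP. Qed.

Lemma braket_inj x y : (forall u, braket u x = braket u y) -> x = y.
Proof.
move=> xy; apply/eqP; rewrite -subr_eq0; apply/eqP/braket_eq0.
by rewrite braketBr xy subrr.
Qed.

Lemma braketCS u v : `|braket u v| <= `|u| * `|v|.
Proof.
have [->|u0] := eqVneq u 0; first by rewrite braket0l !normr0 mul0r.
have nu0 : 0 < `|u| by rewrite normr_gt0.
rewrite -(@ler_pXn2r _ 2) ?nnegrE ?mulr_ge0 //.
have := braket_ge0 (`|u| ^+ 2 *: v - braket u v *: u).
rewrite braketBr !braketBl !braketZr !braketZl !braket_norm.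
rewrite !(conj_Creal (ger0_real (exprn_ge0 _ _))) // -(braketC u v) exprMn.
rewrite normCK; set c := braket u v; set N := `|u|; set M := `|v|.
rewrite (_ : _ - _ = N ^+ 2 * (N ^+ 2 * M ^+ 2 - c * c^* )); last by ring.
by rewrite pmulr_rge0 ?exprn_gt0 // subr_ge0.
Qed.

Lemma braket_continuous u : continuous (braket u : H -> R[i]^o).
Proof.
move=> x; apply/cvgrPdist_lt => eps eps_gt0.
have Nu : 0 < `|u| + 1 by rewrite ltr_wpDl.
near=> y; rewrite -braketBr; apply: le_lt_trans (braketCS _ _) _.
apply: (@le_lt_trans _ _ ((`|u| + 1) * `|x - y|)).
  by rewrite ler_wpM2r // lerDl.
rewrite -ltr_pdivlMl // mulrC.
near: y; apply: cvgr_dist_lt => //.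
by rewrite divr_gt0.
Unshelve. all: by end_near. Qed.

Lemma normD_sq_orthogonal x y : braket x y = 0 -> `|x + y| ^+ 2 = `|x| ^+ 2 + `|y| ^+ 2.
Proof.
move=> xy; rewrite -!braket_norm braketDr !braketDl xy.
by rewrite -(braketC x y) xy rmorph0 add0r addr0.
Qed.

Lemma dense_approx (S : set H) x (eps : R[i]) : dense S -> 0 < eps ->
  exists2 y, S y & `|x - y| < eps.
Proof.
move=> dS eps_gt0; have [||y [/= xy Sy]] := dS (ball x eps).
- by exists x; apply: ballxx.
- exact: ball_open.
by exists y => //; rewrite -ball_normE in xy.
Qed.

End Braket.

Section Parseval.
Variables (R : realType) (H : hilbert R) (I : countType) (f : I -> H).
Hypothesis f_basis : orthonormal_basis f.
Implicit Types (u v x y : H).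

(* The basis listed along the pickling of its index type, padded with zeros. *)
Definition basis_seq (k : nat) : H := oapp f 0 (@pickle_inv I k).
Local Notation g := basis_seq.

Lemma basis_seq_pickle i : g (pickle i) = f i.
Proof. by rewrite /basis_seq pickleK_inv. Qed.

Lemma basis_seq_basis k i : braket (g k) (f i) = (k == pickle i)%:R.
Proof.
have [f_on _] := f_basis; rewrite /basis_seq.
case E: (pickle_inv k) (@pickle_invK I k) => [j|] /= => [<-|_].
  by rewrite f_on (inj_eq (pcan_inj (@pickleK_inv I))).
rewrite braket0l; case: eqP => // ki.
by move: E; rewrite ki pickleK_inv.
Qed.

Lemma basis_seq_orthogonal k l : k != l -> braket (g k) (g l) = 0.
Proof.
move=> kl; rewrite {2}/basis_seq.
case E: (pickle_inv l) (@pickle_invK I l) => [j|] /= => [jl|_]; last by rewrite braket0r.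
by rewrite basis_seq_basis jl (negbTE kl).
Qed.

(** The first factor is 1 at the code of a basis index and 0 at the padding, where both sides
    vanish. *)
Lemma basis_seq_idem k x : braket (g k) (g k) * braket (g k) x = braket (g k) x.
Proof.
rewrite {2 3 4}/basis_seq.
case E: (pickle_inv k) (@pickle_invK I k) => [j|] /= => [jk|_].
  by rewrite basis_seq_basis jk eqxx mul1r.
by rewrite braket0l mulr0.
Qed.

Definition basis_proj (N : nat) x : H := \sum_(k < N) braket (g k) x *: g k.

Lemma basis_proj_coord N x (k : 'I_N) :
  braket (g k) (basis_proj N x) = braket (g k) x.
Proof.
rewrite /basis_proj braket_sumr (bigD1 k) //= big1 => [|l lk].
  by rewrite addr0 braketZr mulrC basis_seq_idem.
by rewrite braketZr basis_seq_orthogonal ?mulr0 // eq_sym.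
Qed.

Lemma basis_proj_contract N x : `|x - basis_proj N x| <= `|x|.
Proof.
have orth : braket (basis_proj N x) (x - basis_proj N x) = 0.
  rewrite {1}/basis_proj braket_suml big1 // => k _.
  by rewrite braketZl braketBr basis_proj_coord subrr mulr0.
have := normD_sq_orthogonal orth; rewrite addrC subrK => xE.
by rewrite -(@ler_pXn2r _ 2) ?nnegrE // xE lerDr exprn_ge0.
Qed.

Lemma basis_projB N x y : basis_proj N (x - y) = basis_proj N x - basis_proj N y.
Proof.
by rewrite /basis_proj -sumrB; apply: eq_bigr => k _; rewrite braketBr scalerBl.
Qed.

Lemma basis_proj_id y : lspan (range f) y ->
  exists N0, forall N, (N0 <= N)%N -> basis_proj N y = y.
Proof.
move=> [m [c [v [v_range ->]]]].
have [j jE] : exists j : 'I_m -> I, forall i, f (j i) = v i.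
  have j i : {l | f l = v i} by have /cid2[l _ fl] := v_range i; exists l.
  by exists (fun i => sval (j i)) => i; case: (j i).
exists (\max_i (pickle (j i)).+1) => N N_ge.
rewrite /basis_proj; under eq_bigr do rewrite braket_sumr scaler_suml.
rewrite exchange_big; apply: eq_bigr => i _ /=.
have i_N : (pickle (j i) < N)%N by apply: leq_trans N_ge; apply: (leq_bigmax i).
rewrite (bigD1 (Ordinal i_N)) //= big1 => [|k /eqP k_i].
  by rewrite addr0 braketZr -jE basis_seq_pickle f_basis.1 eqxx mulr1.
rewrite braketZr -jE basis_seq_basis; case: eqP => [ki|_]; last by rewrite mulr0 scale0r.
by case: k_i; apply: val_inj.
Qed.

(** A nearby finite combination [y] is eventually fixed by the projections, so the residual of [x]
    is that of [x - y], which the contraction bounds by [|x - y|]. *)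
Lemma basis_proj_cvg x : basis_proj N x @[N --> \oo] --> x.
Proof.
apply/cvgrPdist_lt => eps eps_gt0.
have [y y_span xy] := dense_approx x f_basis.2 eps_gt0.
have [N0 proj_y] := basis_proj_id y_span.
near=> N; have -> : x - basis_proj N x = (x - y) - basis_proj N (x - y).
  by rewrite basis_projB proj_y ?opprB ?addrA ?subrK //; near: N; exists N0.
by apply: le_lt_trans (basis_proj_contract _ _) _.
Unshelve. all: by end_near. Qed.

Lemma parseval u v :
  \sum_(k < N) braket u (g k) * braket (g k) v @[N --> \oo] --> (braket u v : R[i]^o).
Proof.
rewrite (_ : (fun N => _) = (fun N => braket u (basis_proj N v) : R[i]^o)).
  have := @cvg_comp _ _ _ (fun N => basis_proj N v) (braket u : H -> R[i]^o) _ _ _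
    (@basis_proj_cvg v) (@braket_continuous R H u v).
  by move=> h; exact: h.
apply/funext => N; rewrite braket_sumr; apply: eq_bigr => k _.
by rewrite braketZr mulrC.
Qed.

End Parseval.

Section OperatorTrace.
Variables (R : realType) (H : hilbert R).
Implicit Types (A B S T : H -> H) (u v x y a b : H).

Lemma has_trace_rank_one a b :
  has_trace (fun x => braket b x *: a) (braket b a).
Proof.
move=> I f f_basis; have := @parseval R H I f f_basis b a.
rewrite (_ : (fun N => _) = (fun N => \sum_(k < N)
  oapp (fun i => braket (f i) (braket b (f i) *: a)) 0 (@pickle_inv I k))).
  by move=> h; exact: h.
apply/funext => N; apply: eq_bigr => k _; rewrite /basis_seq.
by case: pickle_inv => [i|] /=; rewrite ?braketZr // braket0l mulr0.
Qed.

Lemma has_traceD A B s t :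
  has_trace A s -> has_trace B t -> has_trace (fun x => A x + B x) (s + t).
Proof.
move=> As Bt I f f_basis; pose tr C N := \sum_(k < N)
  oapp (fun i => braket (f i) (C (f i))) 0 (@pickle_inv I k).
rewrite (_ : (fun N => _) = (fun N => tr A N + tr B N)).
  exact: (@cvgD _ R[i]^o _ _ _ _ _ _ _ (As I f f_basis) (Bt I f f_basis)).
apply/funext => N; rewrite /tr -big_split; apply: eq_bigr => k _ /=.
by case: pickle_inv => [i|] /=; rewrite ?braketDr ?addr0.
Qed.

Lemma has_traceZ A s (c : R[i]) :
  has_trace A s -> has_trace (fun x => c *: A x) (c * s).
Proof.
move=> As I f f_basis; pose tr N := \sum_(k < N)
  oapp (fun i => braket (f i) (A (f i))) 0 (@pickle_inv I k).
rewrite (_ : (fun N => _) = (fun N => c * tr N)).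
  exact: (@cvgMl_tmp _ _ _ _ tr c s (As I f f_basis)).
apply/funext => N; rewrite /tr mulr_sumr; apply: eq_bigr => k _ /=.
by case: pickle_inv => [i|] /=; rewrite ?braketZr ?mulr0.
Qed.

(** A countable basis must be exhibited: without one, [has_trace] would hold vacuously for every
    value. *)
Lemma op_traceE (I : countType) (f : I -> H) A s :
  orthonormal_basis f -> has_trace A s -> op_trace A = s.
Proof.
move=> f_basis As; apply: xget_unique => // t At.
exact: (cvg_unique (@norm_hausdorff _ R[i]^o) (At I f f_basis) (As I f f_basis)).
Qed.

(** Polarization: the form is real at [x + y] and at [x + 'i *: y], which yields two equations
    between the cross terms and their conjugates. *)
Lemma psd_symmetric A x y : psd A -> braket (A x) y = braket x (A y).
Proof.
move=> [[A_lin A_cont] A_ge0].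
have AD u v : A (u + v) = A u + A v by have := A_lin 1 u v; rewrite !scale1r.
have A0 : A 0 = 0 by apply: (addrI (A 0)); rewrite -AD !addr0.
have AZ c u : A (c *: u) = c *: A u by have := A_lin c u 0; rewrite A0 !addr0.
have real u : (braket u (A u))^* = braket u (A u).
  by apply: conj_Creal; apply: ger0_real.
have E1 := real (x + y); have E2 := real (x + 'i *: y).
rewrite AD !braketDr !braketDl !rmorphD /= !real in E1.
rewrite AD AZ !braketDr !braketDl !braketZr !braketZl !rmorphD !rmorphM /= !real in E2.
rewrite conjCK !conjCi in E2.
rewrite -[LHS]braketC.
have i0 : 'i != 0 :> R[i] by rewrite neq0Ci.
set p := braket x (A y) in E1 E2 *; set q := braket y (A x) in E1 E2 *.
have {}E1 : p^* + q^* = p + q.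
  move/eqP: E1; rewrite -subr_eq0 => /eqP E1; apply/eqP.
  by rewrite -subr_eq0 -[X in _ == X]E1; apply/eqP; ring.
have {}E2 : q^* - p^* = p - q.
  move/eqP: E2; rewrite -subr_eq0 => /eqP E2; apply: (mulfI i0); apply/eqP.
  by rewrite -subr_eq0 -[X in _ == X]E2; apply/eqP; ring.
apply: (mulfI (_ : 2 != 0 :> R[i])); first by rewrite pnatr_eq0.
transitivity ((p^* + q^* ) + (q^* - p^* )); first by ring.
by rewrite E1 E2; ring.
Qed.

End OperatorTrace.

Section Operators.
Variables (R : realType) (H : hilbert R).
Implicit Types (A B S T : H -> H) (x y a b phi psi : H).

Lemma bounded_rank_one a b : bounded_op (fun x => braket b x *: a : H).
Proof.
split=> [c x y|x]; first by rewrite braketDr braketZr scalerDl scalerA.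
exact: (@cvgZr_tmp _ _ _ _ _ (braket b) (braket b x) a (@braket_continuous R H b x)).
Qed.

Lemma bounded_opD A B : bounded_op A -> bounded_op B -> bounded_op (fun x => A x + B x).
Proof.
move=> [linA contA] [linB contB]; split=> [c x y|x].
  by rewrite linA linB scalerDr addrACA.
by apply: cvgD; [apply: contA|apply: contB].
Qed.

Lemma bounded_opZ (c : R[i]) A : bounded_op A -> bounded_op (fun x => c *: A x).
Proof.
move=> [linA contA]; split=> [d x y|x].
  by rewrite linA scalerDr !scalerA mulrC.
by apply: cvgZl_tmp; apply: contA.
Qed.

Lemma bounded_op_comp A B : bounded_op A -> bounded_op B -> bounded_op (A \o B).
Proof.
move=> [linA contA] [linB contB]; split=> [d x y|x]; first by rewrite /= linB linA.
by apply: continuous_comp; [apply: contB|apply: contA].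
Qed.

Lemma bounded_op_id : bounded_op (id : H -> H).
Proof. by split=> // x; apply: cvg_id. Qed.

Lemma bounded_op0 : bounded_op (fun=> 0 : H).
Proof.
split=> [c x y|x]; first by rewrite scaler0 addr0.
exact: cvg_cst.
Qed.

Lemma bounded_op_sum (I : Type) (r : seq I) (P : pred I) (F : I -> H -> H) :
  (forall i, bounded_op (F i)) -> bounded_op (fun x => \sum_(i <- r | P i) F i x).
Proof.
move=> bF; elim: r => [|i r IHr].
  by under eq_fun do rewrite big_nil; exact: bounded_op0.
under eq_fun do rewrite big_cons; case: (P i) => //.
exact: bounded_opD.
Qed.

Lemma bounded_opB A B : bounded_op A -> bounded_op B -> bounded_op (A \- B).
Proof.
move=> bA bB; rewrite (_ : A \- B = fun x => A x + (-1) *: B x).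
  exact/bounded_opD/bounded_opZ.
by apply/funext => x /=; rewrite scaleN1r.
Qed.

Lemma bounded_op_eq0 A : bounded_op A -> A 0 = 0.
Proof.
move=> [linA _]; have := linA 1 0 0; rewrite scaler0 addr0 scale1r => A0.
by apply: (addrI (A 0)); rewrite addr0 -A0.
Qed.

Lemma bounded_op_scale A (c : R[i]) x : bounded_op A -> A (c *: x) = c *: A x.
Proof.
by move=> bA; have := bA.1 c x 0; rewrite (bounded_op_eq0 bA) !addr0.
Qed.

Lemma bounded_op_sub A x y : bounded_op A -> A (x - y) = A x - A y.
Proof.
by move=> bA; have := bA.1 (-1) y x; rewrite !scaleN1r [_ + x]addrC [_ + A x]addrC.
Qed.

(* Uniqueness: a square root S commutes with [B = S^2], hence with [T = l B], so that
   [(S + T) (S - T) = 0]; positivity then kills both S and T on the range of [S - T]. *)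
Lemma sqrt_opE B (l : R[i]) : psd B -> 0 <= l ->
  (forall x, (l * l) *: B (B x) = B x) -> sqrt_op B = (fun x => l *: B x).
Proof.
move=> psdB l_ge0 llBB; have [bB B_ge0] := psdB.
have lC : l^* = l by apply: conj_Creal; apply: ger0_real.
have psdT : psd (fun x => l *: B x).
  split; first exact: bounded_opZ.
  by move=> x; rewrite braketZr mulr_ge0.
apply: xget_unique.
  by split=> //; apply/funext => x /=; rewrite (bounded_op_scale _ _ bB) scalerA.
move=> S [psdS SS]; have [bS S_ge0] := psdS.
have SSx x : S (S x) = B x by rewrite -SS.
have SB x : S (B x) = B (S x) by rewrite -!SSx.
apply/funext => x; apply/eqP; rewrite -subr_eq0; apply/eqP.
set y := S x - l *: B x.
have STy : S y + l *: B y = 0.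
  rewrite /y !(bounded_op_sub _ _ bS) !(bounded_op_sub _ _ bB).
  rewrite (bounded_op_scale _ _ bS) (bounded_op_scale _ _ bB) SSx scalerBr scalerA llBB SB.
  by rewrite addrA subrK subrr.
have yBy : l * braket y (B y) = 0.
  have := congr1 (braket y) STy; rewrite braketDr braketZr braket0r => /eqP.
  by rewrite paddr_eq0 ?mulr_ge0 // => /andP[_ /eqP].
have Ty : l *: B y = 0.
  apply: braket_eq0; rewrite braketZl braketZr lC (psd_symmetric _ _ psdB).
  rewrite mulrA -braketZr llBB; move/eqP: yBy; rewrite mulf_eq0.
  by case/orP => /eqP // l0; rewrite -llBB l0 mul0r scale0r braket0r.
have Sy : S y = 0 by move: STy; rewrite Ty addr0.
apply: braket_eq0; rewrite {1}/y braketBl (psd_symmetric _ _ psdS) Sy braket0r.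
by rewrite braketZl lC (psd_symmetric _ _ psdB) -braketZr Ty braket0r subrr.
Qed.

Lemma adjointE A : bounded_op A -> (forall x y, braket (A x) y = braket x (A y)) ->
  adjoint A = A.
Proof.
move=> bA symA; apply: xget_unique => // B [bB BA].
apply/funext => x; apply: braket_inj => u.
by rewrite -[LHS]braketC BA -symA braketC.
Qed.

End Operators.

(** * Distances between pure states *)

Section PureStateDistances.
Variables (R : realType) (H : hilbert R) (I : countType) (f : I -> H).
Hypothesis f_basis : orthonormal_basis f.
Implicit Types (x y : H).
Variables phi psi : H.
Hypotheses (phi1 : `|phi| = 1) (psi1 : `|psi| = 1).
Local Notation c := (braket phi psi).

Lemma braket_unit_le1 : `|c| <= 1.
Proof. by apply: le_trans (braketCS _ _) _; rewrite phi1 psi1 mulr1. Qed.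

Lemma psd_ketbra x : psd (ketbra x).
Proof.
split=> [|y]; first exact: bounded_rank_one.
by rewrite /ketbra braketZr -[X in _ * X]braketC -normCK exprn_ge0.
Qed.

Let diff := ketbra phi \- ketbra psi.

Let diff_bounded : bounded_op diff.
Proof. exact: bounded_opB (psd_ketbra phi).1 (psd_ketbra psi).1. Qed.

Let diff_sym x y : braket (diff x) y = braket x (diff y).
Proof.
rewrite /diff /= braketBl braketBr.
by rewrite !(psd_symmetric _ _ (psd_ketbra _)).
Qed.

(* [diff] squares to [sin2] times the projection onto the span of [phi] and [psi]. *)
Let sin2 : R[i] := 1 - `|c| ^+ 2.

Let sin2_ge0 : 0 <= sin2.
Proof. by rewrite subr_ge0 exprn_ile1 // braket_unit_le1. Qed.

Let diffE x : diff x = braket phi x *: phi - braket psi x *: psi.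
Proof. by []. Qed.

Let diff_lin a b x y : diff (a *: x - b *: y) = a *: diff x - b *: diff y.
Proof.
by rewrite (bounded_op_sub _ _ diff_bounded) !(bounded_op_scale _ _ diff_bounded).
Qed.

Let diff_phi : diff phi = phi - c^* *: psi.
Proof. by rewrite diffE braket_norm phi1 expr1n scale1r braketC. Qed.

Let diff_psi : diff psi = c *: phi - psi.
Proof. by rewrite diffE braket_norm psi1 expr1n scale1r. Qed.

Let diff2_phi : diff (diff phi) = sin2 *: phi.
Proof.
rewrite {1}diff_phi -[X in X - _]scale1r diff_lin diff_phi diff_psi !scale1r.
rewrite scalerBr scalerA [c^* * c]mulrC -normCK /sin2 scalerBl scale1r.
by rewrite opprB addrA addrNK.
Qed.

Let diff2_psi : diff (diff psi) = sin2 *: psi.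
Proof.
rewrite {1}diff_psi -[X in _ - X]scale1r diff_lin diff_phi diff_psi !scale1r.
rewrite scalerBr scalerA -normCK /sin2 scalerBl scale1r.
by rewrite opprB addrC addrA addrNK.
Qed.

Let diff3 x : diff (diff (diff x)) = sin2 *: diff x.
Proof.
rewrite (diffE x) (diff_lin (braket phi x) (braket psi x)).
rewrite (diff_lin (braket phi x) (braket psi x)) diff2_phi diff2_psi.
by rewrite scalerBr !scalerA mulrC [_ * sin2]mulrC.
Qed.

(** Since [diff] squares to [s^2] times a projection of rank at most two, its absolute value is
    [diff^2 / s], with trace [2 s]. *)
Lemma trdist_ketbra :
  real_complex R (trdist (ketbra phi) (ketbra psi) ^+ 2) = 4 * (1 - `|c| ^+ 2).
Proof.
pose s := sqrtC sin2.
have s_ge0 : 0 <= s by rewrite sqrtC_ge0.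
have ss : s * s = sin2 by rewrite -expr2 sqrtCK.
have sqE : sqrt_op (diff \o diff) = (fun x => s^-1 *: diff (diff x)).
  apply: sqrt_opE => [||x].
  - split; first exact: bounded_op_comp.
    by move=> x /=; rewrite -diff_sym braket_ge0.
  - by rewrite invr_ge0.
  rewrite /= diff3 scalerA -invfM ss.
  (* When [sin2 = 0] its inverse is 0 by convention, so [diff (diff x)] has to be shown to
     vanish. *)
  have [s0|s0] := eqVneq sin2 0; last by rewrite mulVf // scale1r.
  rewrite s0 invr0 mul0r scale0r; apply/esym/braket_eq0.
  by rewrite diff_sym diff3 s0 scale0r braket0r.
have tr : has_trace (fun x => s^-1 *: diff (diff x)) (2 * s).
  have -> : (fun x => s^-1 *: diff (diff x)) =
      (fun x => s^-1 *: (braket phi x *: (phi - c^* *: psi) +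
                          braket psi x *: (psi - c *: phi))).
    apply/funext => x; congr (_ *: _); rewrite (diffE x).
    rewrite (diff_lin (braket phi x) (braket psi x)) diff_phi diff_psi.
    by rewrite -[X in _ + X = _]scalerN opprB.
  have -> : 2 * s = s^-1 * (braket phi (phi - c^* *: psi) + braket psi (psi - c *: phi)).
    rewrite !braketBr !braketZr !braket_norm phi1 psi1 expr1n -(braketC phi psi).
    rewrite [c^* * c]mulrC -normCK -/sin2 -ss.
    by have [->|s0] := eqVneq s 0; [rewrite !mulr0 addr0 mulr0|field].
  by apply/has_traceZ/has_traceD; apply: has_trace_rank_one.
rewrite /trdist /abs_op adjointE // sqE (op_traceE f_basis tr).
rewrite rmorphXn /= RRe_real; last by apply: ger0_real; rewrite mulr_ge0.
by rewrite exprMn expr2 -natrM [s ^+ 2]sqrtCK.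
Qed.

(** Sandwiching gives [|c|^2] times a projection, whose root is [|c|] times it. The root is written
    with [|c|^-1] to fit [sqrt_opE], and the convention [0^-1 = 0] keeps this right at [c = 0]. *)
Lemma bures_ketbra :
  real_complex R (bures (ketbra phi) (ketbra psi) ^+ 2) = 2 * (1 - `|c|).
Proof.
have ketbra_idem x : ketbra phi (ketbra phi x) = ketbra phi x.
  by rewrite /ketbra braketZr braket_norm phi1 expr1n mulr1.
rewrite /bures; have -> : sqrt_op (ketbra phi) = ketbra phi.
  rewrite (@sqrt_opE _ _ (ketbra phi) 1) //.
  - by apply/funext => x; rewrite scale1r.
  - exact: psd_ketbra.
  - by move=> x; rewrite mulr1 scale1r ketbra_idem.
have sandwich : ketbra phi \o ketbra psi \o ketbra phi = (fun x => `|c| ^+ 2 *: ketbra phi x).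
  apply/funext => x; rewrite /= /ketbra !braketZr !scalerA normCK.
  by rewrite (braketC phi psi); congr (_ *: _); ring.
rewrite sandwich (@sqrt_opE _ _ _ (`|c|^-1)); first last.
- move=> x; rewrite (bounded_op_scale _ _ (psd_ketbra phi).1) ketbra_idem !scalerA.
  have [->|c0] := eqVneq `|c| 0; first by rewrite expr0n /= !mulr0.
  by congr (_ *: _); field.
- by rewrite invr_ge0.
- split; first exact/bounded_opZ/(psd_ketbra phi).1.
  by move=> x; rewrite braketZr mulr_ge0 ?exprn_ge0 // (psd_ketbra phi).2.
have tr : has_trace (fun x => `|c|^-1 *: (`|c| ^+ 2 *: ketbra phi x)) `|c|.
  have cE : `|c| = `|c|^-1 * (`|c| ^+ 2 * braket phi phi).
    rewrite braket_norm phi1 expr1n mulr1.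
    have [->|c0] := eqVneq `|c| 0; first by rewrite expr0n mulr0.
    by field.
  rewrite [X in has_trace _ X]cE.
  by do 2!apply: has_traceZ; apply: has_trace_rank_one.
rewrite (op_traceE f_basis tr).
have := braket_unit_le1; have := RRe_real (normr_real c).
set r := complex.Re _ => <-; rewrite -[1]/(real_complex R 1) lecR => r1.
rewrite sqr_sqrtr ?mulr_ge0 ?subr_ge0 //.
by rewrite rmorphM rmorphB /= rmorph_nat.
Qed.

(** A common bound by the squared sine lets one estimator serve both distances. *)
Lemma pure_state_distance_le (dist : (H -> H) -> (H -> H) -> R) :
  dist = @trdist R H \/ dist = @bures R H ->
  real_complex R (dist (ketbra phi) (ketbra psi) ^+ 2) <= 4 * (1 - `|c| ^+ 2).
Proof.
case=> ->; first by rewrite trdist_ketbra.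
rewrite bures_ketbra; have c1 := braket_unit_le1.
rewrite -subr_ge0 (_ : _ - _ = 2 * (1 - `|c|) * (1 + 2 * `|c|)); last by ring.
by rewrite !mulr_ge0 ?subr_ge0 ?addr_ge0 ?mulr_ge0.
Qed.

End PureStateDistances.

(** * Tensor powers *)

Section Approximation.
Variables (R : realType) (H : hilbert R).
Implicit Types (S : set H) (x y : H).

Definition approximable S x := forall eps : R[i], 0 < eps ->
  exists2 y, lspan S y & `|x - y| < eps.

Lemma lspan_mem S x : S x -> lspan S x.
Proof.
move=> Sx; exists 1%N, (fun=> 1), (fun=> x); split=> //.
by rewrite big_ord1 scale1r.
Qed.

Lemma lspanD S x y : lspan S x -> lspan S y -> lspan S (x + y).
Proof.
move=> [m [c [v [Sv ->]]]] [m' [c' [v' [Sv' ->]]]].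
exists (m + m')%N, (fun i => match fintype.split i with inl j => c j | inr j => c' j end).
exists (fun i => match fintype.split i with inl j => v j | inr j => v' j end); split.
  by move=> i; case: (fintype.split i).
rewrite big_split_ord /=; congr (_ + _); apply: eq_bigr => i _.
  by rewrite (unsplitK (inl i)).
by rewrite (unsplitK (inr i)).
Qed.

Lemma lspanZ S (a : R[i]) x : lspan S x -> lspan S (a *: x).
Proof.
move=> [m [c [v [Sv ->]]]]; exists m, (fun i => a * c i), v; split=> //.
by rewrite scaler_sumr; apply: eq_bigr => i _; rewrite scalerA.
Qed.

Lemma lspan0 S : lspan S 0.
Proof. by exists 0%N, (fun=> 0), (fun=> 0); split=> [[]|] //; rewrite big_ord0. Qed.

Lemma approximableD S x y : approximable S x -> approximable S y -> approximable S (x + y).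
Proof.
move=> Sx Sy eps eps_gt0; have eps2 : 0 < eps / 2 by rewrite divr_gt0.
have [x' Sx' xx'] := Sx _ eps2; have [y' Sy' yy'] := Sy _ eps2.
exists (x' + y'); first exact: lspanD.
rewrite opprD addrACA; apply: le_lt_trans (ler_normD _ _) _.
by rewrite [eps]splitr ltrD.
Qed.

Lemma approximableZ S (a : R[i]) x : approximable S x -> approximable S (a *: x).
Proof.
move=> Sx eps eps_gt0; have a1 : 0 < `|a| + 1 by rewrite ltr_wpDl.
have [|x' Sx' xx'] := Sx (eps / (`|a| + 1)); first by rewrite divr_gt0.
exists (a *: x'); first exact: lspanZ.
rewrite -scalerBr normrZ; apply: (@le_lt_trans _ _ ((`|a| + 1) * `|x - x'|)).
  by rewrite ler_wpM2r // lerDl.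
by rewrite mulrC -ltr_pdivlMr.
Qed.

Lemma approximable_sum S m (c : 'I_m -> R[i]) (v : 'I_m -> H) :
  (forall i, approximable S (v i)) -> approximable S (\sum_(i < m) c i *: v i).
Proof.
move=> Sv; apply: (big_ind (approximable S)) => [eps eps_gt0|x y|i _].
- by exists 0; [exact: lspan0|rewrite subrr normr0].
- exact: approximableD.
- exact: approximableZ.
Qed.

Lemma approximable_trans S x : (forall eps : R[i], 0 < eps ->
  exists2 y, approximable S y & `|x - y| < eps) -> approximable S x.
Proof.
move=> Sx eps eps_gt0; have eps2 : 0 < eps / 2 by rewrite divr_gt0.
have [y Sy xy] := Sx _ eps2; have [z Sz yz] := Sy _ eps2; exists z => //.
rewrite -(subrK y x) -addrA; apply: le_lt_trans (ler_normD _ _) _.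
by rewrite [eps]splitr ltrD.
Qed.

Lemma dense_approximable S : (forall x, approximable S x) -> dense (lspan S).
Proof.
move=> Sx O [x Ox] openO; have := open_nbhs_nbhs (conj openO Ox).
move=> /nbhs_ballP[eps /= eps_gt0 ball_O].
have [y Sy xy] := Sx x eps eps_gt0; exists y; split=> //; apply: ball_O.
by rewrite -ball_normE.
Qed.

(** Otherwise some [y] in [S] is closer to [x] than [|x|], and [|x|^2 = <x - y, x>] would be less
    than [|x|^2]. *)
Lemma dense_orthogonal S x : dense S -> (forall y, S y -> braket y x = 0) -> x = 0.
Proof.
move=> dS Sx; apply/eqP; rewrite -normr_le0; apply/negPn/negP => x0.
have {}x0 : 0 < `|x| by rewrite normr_gt0; apply: contra x0 => /eqP ->; rewrite normr0.
have [y Sy xy] := dense_approx x dS x0.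
have : `|x| ^+ 2 < `|x| ^+ 2.
  rewrite -{1}braket_norm -[X in X < _]subr0 -(Sx y Sy) -braketBl.
  rewrite -[X in X < _]ger0_norm; last first.
    by rewrite braketBl (Sx y Sy) subr0 braket_ge0.
  apply: le_lt_trans (braketCS _ _) _.
  by rewrite expr2 ltr_pM2r.
by rewrite ltxx.
Qed.

Lemma dense_bounded_ext S A B : dense S -> bounded_op A -> bounded_op B ->
  (forall y, S y -> A y = B y) -> A = B.
Proof.
move=> dS bA bB AB; have [_ contD] := bounded_opB bA bB.
apply/funext => x; apply/eqP; rewrite -subr_eq0; apply/negPn/negP => D0.
have Dx : 0 < `|A x - B x| by rewrite normr_gt0.
have /cvgrPdist_lt/(_ _ Dx)/nbhs_ballP[eps /= eps_gt0 ball_D] := contD x.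
have [y Sy xy] := dense_approx x dS eps_gt0.
have := ball_D y; rewrite -ball_normE /= (AB y Sy) subrr subr0 ltxx.
by move=> /(_ xy).
Qed.

Lemma bounded_op_lincomb A m (c : 'I_m -> R[i]) (v : 'I_m -> H) : bounded_op A ->
  A (\sum_(i < m) c i *: v i) = \sum_(i < m) c i *: A (v i).
Proof.
move=> bA; elim/big_rec2: _ => [|i y x _ <-]; first exact: bounded_op_eq0.
exact: bA.1.
Qed.

Lemma total_bounded_ext S A B : dense (lspan S) -> bounded_op A -> bounded_op B ->
  (forall y, S y -> A y = B y) -> A = B.
Proof.
move=> dS bA bB AB; apply: (dense_bounded_ext dS) => // _ [m [c [v [Sv ->]]]].
by rewrite !bounded_op_lincomb //; apply: eq_bigr => i _; rewrite AB.
Qed.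

Lemma total_inj S x y : dense (lspan S) ->
  (forall w, S w -> braket w x = braket w y) -> x = y.
Proof.
move=> dS Sxy; apply/eqP; rewrite -subr_eq0; apply/eqP.
apply: (dense_orthogonal dS) => _ [m [c [v [Sv ->]]]].
rewrite braket_suml big1 // => i _.
by rewrite braketZl braketBr Sxy // subrr mulr0.
Qed.

End Approximation.

Section TensorPower.
Variables (R : realType) (H : hilbert R) (n : nat) (K : tensor_power H n).
Implicit Types (u v : 'I_n -> H) (i : 'I_n) (x y : H).

Lemma tens_update_id u i : tens K [eta u with i |-> u i] = tens K u.
Proof. by congr (tens K _); apply/funext => j /=; case: eqP => [->|]. Qed.

Lemma tens_updateB u i x y :
  tens K [eta u with i |-> x - y] =
  tens K [eta u with i |-> x] - tens K [eta u with i |-> y].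
Proof. by rewrite addrC -scaleN1r tens_multilinear scaleN1r addrC. Qed.

Lemma tens_update0 u i : tens K [eta u with i |-> 0] = 0.
Proof. by rewrite -(subrr 0) tens_updateB subrr. Qed.

Lemma tens_update_sum u i m (c : 'I_m -> R[i]) (v : 'I_m -> H) :
  tens K [eta u with i |-> \sum_(k < m) c k *: v k] =
  \sum_(k < m) c k *: tens K [eta u with i |-> v k].
Proof.
elim/big_rec2: _ => [|k y x _ <-]; first exact: tens_update0.
exact: tens_multilinear.
Qed.

Lemma norm_tens u : `|tens K u| = \prod_i `|u i|.
Proof.
apply/eqP; rewrite -(@eqrXn2 _ 2) ?prodr_ge0 // -braket_norm tens_braket.
by rewrite -prodrXl; apply/eqP/eq_bigr => i _; rewrite braket_norm.
Qed.

Lemma braket_tens_orthonormal (J : eqType) (g : J -> H) (f f' : {ffun 'I_n -> J}) :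
  (forall a b, braket (g a) (g b) = (a == b)%:R) ->
  braket (tens K (fun i => g (f i))) (tens K (fun i => g (f' i))) = (f == f')%:R.
Proof.
move=> g_on; rewrite tens_braket; have [->|/eqP ff'] := eqVneq f f'.
  by rewrite big1 // => i _; rewrite g_on eqxx.
have [i /negbTE ffi] : exists i, f i != f' i.
  apply/existsP; rewrite -negb_forall; apply/negP => /forallP eq_ff'.
  by apply: ff'; apply/ffunP => i; apply/eqP.
by rewrite (bigD1 i) //= g_on ffi mul0r.
Qed.

Variables (e : nat -> H).
Hypothesis e_basis : orthonormal_basis e.

Definition tens_basis (f : {ffun 'I_n -> nat}) : K := tens K (fun i => e (f i)).

(* The factors of [u] are replaced by combinations of basis vectors one at a time. *)
Lemma tens_basis_approximable u : approximable (range tens_basis) (tens K u).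
Proof.
(* Only the first [k] factors are still arbitrary; the others are already basis vectors. *)
suff key k : (k <= n)%N -> forall u, (forall i, (k <= i)%N -> range e (u i)) ->
    approximable (range tens_basis) (tens K u).
  by apply: (key n) => // i; rewrite leqNgt ltn_ord.
elim: k => [|k IHk] k_n {}u u_range.
  have [f fE] : exists f : 'I_n -> nat, forall i, e (f i) = u i.
    have f i : {l | e l = u i} by have /cid2[l _ <-] := u_range i isT; exists l.
    by exists (fun i => sval (f i)) => i; case: (f i).
  move=> eps eps_gt0; exists (tens K u); last by rewrite subrr normr0.
  apply: lspan_mem; exists [ffun i => f i] => //; rewrite /tens_basis.
  by congr (tens K _); apply/funext => i; rewrite ffunE fE.
pose i0 := Ordinal k_n; apply: approximable_trans => eps eps_gt0.
pose M := \prod_(i | i != i0) `|u i| + 1.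
have M_gt0 : 0 < M by rewrite ltr_wpDl ?prodr_ge0.
have [|x [m [c [v [v_range ->]]]] ux] := dense_approx (u i0) e_basis.2 (_ : 0 < eps / M).
  by rewrite divr_gt0.
exists (tens K [eta u with i0 |-> \sum_(j < m) c j *: v j]).
  rewrite tens_update_sum; apply: approximable_sum => j.
  apply: IHk (ltnW k_n) _ _ => i k_i /=; case: eqP => [_|/eqP i_i0]; first exact: v_range.
  apply: u_range; rewrite ltn_neqAle k_i andbT; apply: contra i_i0 => /eqP ki.
  by apply/eqP/val_inj.
rewrite -{1}(tens_update_id u i0) -tens_updateB norm_tens (bigD1 i0) //= eqxx.
rewrite (eq_bigr (fun i => `|u i|)) => [|i /negbTE -> //].
apply: (@le_lt_trans _ _ (`|u i0 - \sum_(j < m) c j *: v j| * M)).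
  by rewrite ler_wpM2l // lerDl.
by rewrite -ltr_pdivlMr.
Qed.

Lemma tens_orthonormal_basis : orthonormal_basis tens_basis.
Proof.
split=> [f g|]; first exact: braket_tens_orthonormal e_basis.1.
apply: dense_approximable => x; apply: approximable_trans => eps eps_gt0.
have [y [m [c [v [v_range ->]]]] xy] := dense_approx x (@tens_dense _ _ _ K) eps_gt0.
exists (\sum_(i < m) c i *: v i) => //; apply: approximable_sum => i.
by have [u _ <-] := v_range i; apply: tens_basis_approximable.
Qed.

Lemma tens_inj (a b : K) :
  (forall u, braket (tens K u) a = braket (tens K u) b) -> a = b.
Proof. by move=> ab; apply: (total_inj (@tens_dense _ _ _ K)) => _ [u _ <-]. Qed.

Lemma op_power_ketbra (psi : H) :
  op_power K (ketbra psi) = ketbra (tens K (fun=> psi)).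
Proof.
have ketbra_tens u : ketbra (tens K (fun=> psi)) (tens K u) =
    tens K (fun i => ketbra psi (u i)).
  apply: tens_inj => w; rewrite /ketbra braketZr !tens_braket -big_split.
  by apply: eq_bigr => i _; rewrite braketZr.
apply: xget_unique.
  by split; [exact: bounded_rank_one|exact: ketbra_tens].
move=> T [bT TE]; apply: (total_bounded_ext (@tens_dense _ _ _ K)) => //.
  exact: bounded_rank_one.
by move=> _ [u _ <-]; rewrite TE ketbra_tens.
Qed.

(** Tested against product vectors, the expansion becomes distributivity of a product over sums,
    which replaces an induction on the factors. *)
Lemma tens_const_sum (m : nat) (z : 'I_m -> R[i]) :
  tens K (fun=> \sum_j z j *: e j) =
  \sum_(f : {ffun 'I_n -> 'I_m}) (\prod_i z (f i)) *: tens K (fun i => e (f i)).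
Proof.
apply: tens_inj => w; rewrite tens_braket braket_sumr.
under eq_bigr do rewrite braket_sumr.
rewrite bigA_distr_bigA; apply: eq_bigr => f _.
rewrite braketZr tens_braket -big_split; apply: eq_bigr => i _.
by rewrite braketZr.
Qed.

End TensorPower.

(** * Measurements with finitely many outcomes *)

Section FinitePovm.
Variables (R : realType) (K : hilbert R) (m : nat) (A : 'I_m -> K -> K).
Hypothesis A_psd : forall j, psd (A j).
Hypothesis A_sum : forall x, \sum_j A j x = x.

Definition fin_povm_op (E : set nat) (x : K) : K := \sum_(j < m | `[< E j >]) A j x.

Lemma fin_povm_psd E : psd (fin_povm_op E).
Proof.
split=> [|x]; first by apply: bounded_op_sum => j; case: (A_psd j).
by rewrite /fin_povm_op braket_sumr sumr_ge0 // => j _; case: (A_psd j).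
Qed.

(** Each of the finitely many labels lies in at most one [F k], so the partial sums are eventually
    constant. *)
Lemma fin_povm_sigma_additive (F : nat -> set nat) : trivIset setT F -> forall x y,
  \sum_(k < N) braket x (fin_povm_op (F k) y) @[N --> \oo] -->
    (braket x (fin_povm_op (\bigcup_k F k) y) : R[i]^o).
Proof.
move=> tF x y; suff near_eq : \forall N \near \oo,
    \sum_(k < N) braket x (fin_povm_op (F k) y) =
    braket x (fin_povm_op (\bigcup_k F k) y).
  apply: cvg_trans (cvg_cst (braket x (fin_povm_op (\bigcup_k F k) y) : R[i]^o)).
    by apply: near_eq_cvg; near=> N; apply/esym; near: N.
  exact: eventually_filter.
have count (j : nat) : \forall N \near \oo,
    (\sum_(k < N) `[< F k j >] = `[< (\bigcup_k F k) j >])%N.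
  have [[k0 _ Fk0]|nF] := pselect ((\bigcup_k F k) j); last first.
    near=> N; rewrite (asboolF nF) big1 // => k _; rewrite asboolF // => Fk.
    by apply: nF; exists k.
  near=> N; have k0N : (k0 < N)%N by near: N; exists k0.+1.
  rewrite (bigD1 (Ordinal k0N)) //= big1 => [|k k_k0].
    by rewrite addn0 !asboolT //; exists k0.
  rewrite asboolF // => Fk; move/eqP: k_k0; apply; apply: val_inj => /=.
  by apply: (tF k k0) => //; exists j.
have near_count : \forall N \near \oo, forall j : 'I_m,
    (\sum_(k < N) `[< F k j >] = `[< (\bigcup_k F k) j >])%N.
  by apply: filter_forall => j; apply: count.
near=> N; have countN : forall j : 'I_m,
    (\sum_(k < N) `[< F k j >] = `[< (\bigcup_k F k) j >])%N by near: N.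
have expand E : braket x (fin_povm_op E y) =
    \sum_j (nat_of_bool `[< E (nat_of_ord j) >])%:R * braket x (A j y).
  rewrite braket_sumr big_mkcond; apply: eq_bigr => j _.
  by case: ifP; rewrite ?mul1r ?mul0r.
rewrite expand; under eq_bigr do rewrite expand.
rewrite exchange_big; apply: eq_bigr => j _ /=.
by rewrite -mulr_suml -natr_sum countN.
Unshelve. all: by end_near. Qed.

Lemma fin_povm_total : fin_povm_op setT = id.
Proof.
apply/funext => x; rewrite /fin_povm_op -[RHS]A_sum.
by apply: eq_bigl => j; rewrite asboolT.
Qed.

Definition fin_povm : povm nat K :=
  @Povm R _ nat K fin_povm_op (fun E _ => fin_povm_psd E)
    (fun F _ tF => fin_povm_sigma_additive tF) fin_povm_total.

End FinitePovm.

Section FiniteEstimator.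
Variables (R : realType) (H : hilbert R) (n : nat) (K : tensor_power H n).
Variables (m : nat) (A : 'I_m -> K -> K).
Hypothesis A_psd : forall j, psd (A j).
Hypothesis A_sum : forall x, \sum_j A j x = x.
Variable out : nat -> H -> H.
Hypothesis out_pure : forall w, pure_states H (out w).

Definition fin_estimator : estimator K :=
  @Estimator R H n K _ nat (fin_povm A_psd A_sum) out out_pure
    (fun _ _ _ => I).

Variables (e : nat -> H).
Hypothesis e_basis : orthonormal_basis e.
Variable psi : H.
Let Psi := tens K (fun=> psi).

Lemma outcome_law_fin (E : set nat) :
  outcome_law (fin_povm A_psd A_sum) (ketbra psi) E =
  (\sum_(j < m | `[< E j >]) complex.Re (braket Psi (A j Psi)))%:E.
Proof.
rewrite /outcome_law op_power_ketbra -/Psi; congr (_%:E).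
have tr : has_trace (ketbra Psi \o fin_povm A_psd A_sum E)
    (braket Psi (fin_povm A_psd A_sum E Psi)).
  rewrite -(psd_symmetric _ _ (fin_povm_psd A_psd E)).
  rewrite (_ : _ \o _ = fun x => braket (fin_povm_op A E Psi) x *: Psi).
    exact: has_trace_rank_one.
  apply/funext => x /=; rewrite /ketbra.
  by rewrite -(psd_symmetric _ _ (fin_povm_psd A_psd E)).
rewrite (op_traceE (tens_orthonormal_basis K e_basis) tr).
by rewrite braket_sumr raddf_sum.
Qed.

Lemma risk_fin (dist : (H -> H) -> (H -> H) -> R) :
  risk fin_estimator dist (ketbra psi) =
  (\sum_(j < m) complex.Re (braket Psi (A j Psi)) * dist (out j) (ketbra psi) ^+ 2)%:E.
Proof.
(* Extending the probabilities by 0 beyond [m] presents the outcome law as a sum of weighted Dirac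
   measures indexed by [nat]. *)
pose p (k : nat) : R := oapp (fun j : 'I_m => complex.Re (braket Psi (A j Psi))) 0 (insub k).
have p_ge0 k : 0 <= p k.
  rewrite /p; case: insub => //= j; have [_ /(_ Psi)] := A_psd j.
  by rewrite lecE => /andP[_].
pose nu k : {measure set nat -> \bar R} := mscale (NngNum (p_ge0 k)) \d_k.
rewrite /risk (_ : outcome_law _ _ = msum nu m).
  rewrite ge0_integral_measure_sum //=; last by move=> x _; rewrite lee_fin sqr_ge0.
  rewrite -sumEFin; apply: eq_bigr => j _.
  rewrite ge0_integral_mscale //=; last by move=> x _; rewrite lee_fin sqr_ge0.
  rewrite integral_dirac // diracT mul1e [RHS]EFinM; congr (_%:E * _)%E.
  by rewrite /p valK.
apply/funext => E; rewrite outcome_law_fin /msum big_mkcond -sumEFin.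
apply: eq_bigr => j _; rewrite /nu /= /mscale /= diracE /p valK /=.
have -> : (j : nat) \in E = `[< E j >] by [].
by case: ifP; rewrite ?mule1 ?mule0.
Qed.

End FiniteEstimator.

(** * The coherent-state estimator *)

Section Bessel.
Variables (R : realType) (H : hilbert R) (J : finType) (g : J -> H).
Hypothesis g_on : forall i j, braket (g i) (g j) = (i == j)%:R.
Implicit Types (x : H) (b : J -> R[i]).

Lemma braket_orthonormal_sum b j : braket (g j) (\sum_i b i *: g i) = b j.
Proof.
rewrite braket_sumr (bigD1 j) //= big1 => [|i ij].
  by rewrite addr0 braketZr g_on eqxx mulr1.
by rewrite braketZr g_on eq_sym (negbTE ij) mulr0.
Qed.

Lemma norm_orthonormal_sum b : `|\sum_j b j *: g j| ^+ 2 = \sum_j `|b j| ^+ 2.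
Proof.
rewrite -braket_norm braket_suml; apply: eq_bigr => j _.
by rewrite braketZl braket_orthonormal_sum mulrC -normCK.
Qed.

Lemma orthonormal_residual x b :
  braket (\sum_j b j *: g j) (x - \sum_j braket (g j) x *: g j) = 0.
Proof.
rewrite braket_suml big1 // => j _.
by rewrite braketZl braketBr braket_orthonormal_sum subrr mulr0.
Qed.

Lemma norm_residual x :
  `|x - \sum_j braket (g j) x *: g j| ^+ 2 = `|x| ^+ 2 - \sum_j `|braket (g j) x| ^+ 2.
Proof.
have := normD_sq_orthogonal (orthonormal_residual x (fun j => braket (g j) x)).
by rewrite addrC subrK norm_orthonormal_sum => ->; rewrite addrAC subrr add0r.
Qed.

Lemma bessel x : \sum_j `|braket (g j) x| ^+ 2 <= `|x| ^+ 2.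
Proof. by rewrite -subr_ge0 -norm_residual exprn_ge0. Qed.

Lemma norm_orthonormal_dist x b : `|x - \sum_j b j *: g j| ^+ 2 =
  \sum_j `|braket (g j) x - b j| ^+ 2 + (`|x| ^+ 2 - \sum_j `|braket (g j) x| ^+ 2).
Proof.
rewrite -norm_residual -norm_orthonormal_sum -normD_sq_orthogonal.
  congr (`|_| ^+ 2); under [X in _ = X + _]eq_bigr do rewrite scalerBl.
  by rewrite sumrB [RHS]addrC addrA subrK.
exact: orthonormal_residual.
Qed.

End Bessel.

Section PureEstimate.
Variables (R : realType) (H : hilbert R) (e0 : H).
Hypothesis e0_unit : `|e0| = 1.

(** The default [e0] keeps the value a unit vector, and [normalizedK] still holds at [y = 0]. *)
Definition normalized (y : H) : H := if y == 0 then e0 else `|y|^-1 *: y.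

Lemma norm_normalized y : `|normalized y| = 1.
Proof.
rewrite /normalized; case: eqP => // /eqP y0.
by rewrite normrZ normfV normr_id mulVf // normr_eq0.
Qed.

Lemma normalizedK y : `|y| *: normalized y = y.
Proof.
rewrite /normalized; case: eqP => [->|/eqP y0]; first by rewrite normr0 scale0r.
by rewrite scalerA mulfV ?scale1r // normr_eq0.
Qed.

(** The left side is the squared distance from [s *: psi] to the line spanned by the normalized
    vector, and [y] is one point of that line. *)
Lemma normalized_error (y psi : H) (s : R[i]) : `|psi| = 1 ->
  `|s| ^+ 2 * (1 - `|braket (normalized y) psi| ^+ 2) <= `|s *: psi - y| ^+ 2.
Proof.
move=> psi1; rewrite -{2}(normalizedK y); set phi := normalized y; set a := `|y|.
have phi1 : `|phi| = 1 by apply: norm_normalized.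
rewrite -subr_ge0 (_ : _ - _ = `|s * braket phi psi - a| ^+ 2) ?exprn_ge0 //.
rewrite -[X in X - _]braket_norm braketBr !braketBl !braketZr !braketZl !braket_norm.
rewrite phi1 psi1 expr1n -(braketC phi psi) !normCK rmorphB rmorphM /=.
by rewrite (_ : a^* = a); [ring|apply: conj_Creal; apply: normr_real].
Qed.

End PureEstimate.

Section CoherentEstimator.
Variables (R : realType) (H : hilbert R) (e : nat -> H).
Hypothesis e_basis : orthonormal_basis e.
Variables (m : nat) (K : tensor_power H m.+1) (N N' : nat).
Hypothesis NN' : (N <= N')%N.
Variables (D : finType) (w zeta : D -> R[i]) (mu : nat -> R[i]) (eps : R).
Hypothesis w_ge0 : forall d, 0 <= w d.
Hypothesis momentE : forall a b, (a <= m.+1)%N -> (b <= m.+1)%N ->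
  \sum_d w d * ((zeta d)^* ^+ a * zeta d ^+ b) = (a == b)%:R * mu a.
Hypothesis ratio_ge : forall f : {ffun 'I_m.+1 -> 'I_N'},
  1 - real_complex R eps <= prod_ratio mu f.
Hypothesis ratio_le1 : forall f : {ffun 'I_m.+1 -> 'I_N'}, prod_ratio mu f <= 1.

Local Notation Om := {ffun 'I_N' -> D}.
Local Notation n := m.+1.
Let nfact : R[i] := n`!%:R.

Definition head_set : {set 'I_N'} := finset (fun j : 'I_N' => (j < N)%N).
Definition coherent_vector (om : Om) : H := \sum_(j < N') prod_point zeta om j *: e j.
Definition coherent_head (om : Om) : H :=
  \sum_(j < N') ((j \in head_set)%:R * prod_point zeta om j) *: e j.
Definition coherent_tens (om : Om) : K := tens K (fun=> coherent_vector om).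
Definition coherent_weight (om : Om) : R[i] := prod_weight w om / nfact.

Definition coherent_op (om : Om) (x : K) : K :=
  (coherent_weight om * braket (coherent_tens om) x) *: coherent_tens om.
Definition remainder_op (x : K) : K := x - \sum_om coherent_op om x.
(* Outcome 0 is the remainder, the others enumerate the points of the design. *)
Definition coherent_family (j : 'I_#|Om|.+1) : K -> K :=
  if unlift ord0 j is Some k then coherent_op (enum_val k) else remainder_op.
Definition coherent_out (k : nat) : H -> H :=
  if obind (unlift ord0) (insub k : option 'I_#|Om|.+1) is Some l
  then ketbra (normalized (e 0%N) (coherent_head (enum_val l)))
  else ketbra (e 0%N).

Let nfact_gt0 : 0 < nfact. Proof. by rewrite ltr0n fact_gt0. Qed.

Let weight_ge0 om : 0 <= coherent_weight om.
Proof. by rewrite divr_ge0 ?(ltW nfact_gt0) // prodr_ge0. Qed.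

Let weightC om : (coherent_weight om)^* = coherent_weight om.
Proof. by apply: conj_Creal; apply: ger0_real. Qed.

Let e_on (i j : 'I_N') : braket (e i) (e j) = (i == j)%:R.
Proof. exact: e_basis.1. Qed.

Let e0_unit : `|e 0%N| = 1.
Proof. by apply/eqP; rewrite -(@eqrXn2 _ 2) // -braket_norm e_basis.1 expr1n. Qed.

Let te (f : {ffun 'I_n -> 'I_N'}) : K := tens K (fun i => e (f i)).

Let te_on f g : braket (te f) (te g) = (f == g)%:R.
Proof. exact: (braket_tens_orthonormal K f g e_on). Qed.

Lemma coherent_overlap om x : braket (coherent_tens om) x =
  prod_form zeta (fun f => braket (te f) x) om.
Proof.
rewrite /coherent_tens tens_const_sum braket_suml; apply: eq_bigr => f _.
by rewrite braketZl rmorph_prod /= mulrC.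
Qed.

Lemma coherent_op_form om x : braket x (coherent_op om x) =
  coherent_weight om * `|braket (coherent_tens om) x| ^+ 2.
Proof. by rewrite braketZr -[braket x _]braketC -mulrA -normCK. Qed.

Lemma coherent_op_psd om : psd (coherent_op om).
Proof.
split=> [|x]; last by rewrite coherent_op_form mulr_ge0 ?exprn_ge0.
rewrite (_ : coherent_op om = fun x => braket (coherent_weight om *: coherent_tens om) x *:
   coherent_tens om); first exact: bounded_rank_one.
by apply/funext => x; rewrite braketZl weightC.
Qed.

(** This makes the remainder effect positive: [x] enters only through its coefficients on the
    orthonormal product vectors [te f]. *)
Lemma coherent_op_sum_le x :
  \sum_om coherent_weight om * `|braket (coherent_tens om) x| ^+ 2 <= `|x| ^+ 2.
Proof.
apply: le_trans (bessel te_on x).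
have := prod_design_bessel momentE ratio_le1 (fun f => braket (te f) x).
rewrite -/nfact -ler_pdivrMl // mulr_sumr; congr (_ <= _).
apply: eq_bigr => om _; rewrite coherent_overlap /coherent_weight.
by rewrite mulrA [nfact^-1 * _]mulrC.
Qed.

Lemma remainder_op_form x : braket x (remainder_op x) =
  `|x| ^+ 2 - \sum_om coherent_weight om * `|braket (coherent_tens om) x| ^+ 2.
Proof.
rewrite braketBr braket_norm braket_sumr; congr (_ - _).
by apply: eq_bigr => om _; rewrite coherent_op_form.
Qed.

Lemma coherent_family_psd j : psd (coherent_family j).
Proof.
rewrite /coherent_family; case: unlift => [k|]; first exact: coherent_op_psd.
split=> [|x]; last by rewrite remainder_op_form subr_ge0 coherent_op_sum_le.
apply: bounded_opB; first exact: bounded_op_id.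
by apply: bounded_op_sum => om; case: (coherent_op_psd om).
Qed.

Lemma coherent_family_big (V : nmodType) (F : option 'I_#|Om| -> V) :
  \sum_(j < #|Om|.+1) F (unlift ord0 j) =
  F None + \sum_om F (Some (enum_rank om)).
Proof.
rewrite big_ord_recl unlift_none; congr (_ + _).
rewrite (reindex enum_rank) /=; last exact/onW_bij/enum_rank_bij.
by apply: eq_bigr => om _; rewrite liftK.
Qed.

Lemma coherent_family_sum x : \sum_j coherent_family j x = x.
Proof.
rewrite (coherent_family_big (fun o => (if o is Some k then coherent_op (enum_val k)
  else remainder_op) x)).
under eq_bigr do rewrite enum_rankK.
exact: subrK.
Qed.

Lemma coherent_out_pure k : pure_states H (coherent_out k).
Proof.
rewrite /coherent_out; case: obind => [l|]; last by exists (e 0%N).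
exists (normalized (e 0%N) (coherent_head (enum_val l))) => //=.
exact: norm_normalized.
Qed.

Definition coherent_estimator : estimator K :=
  fin_estimator coherent_family_psd coherent_family_sum coherent_out_pure.

Variables (psi : H) (dist : (H -> H) -> (H -> H) -> R).
Hypothesis psi1 : `|psi| = 1.
Hypothesis dist_le : dist = @trdist R H \/ dist = @bures R H.
Let Psi := tens K (fun=> psi).
Let c (j : 'I_N') : R[i] := braket (e j) psi.
Let q : R[i] := \sum_(j < N) `|braket (e j) psi| ^+ 2.
Let q' : R[i] := \sum_(j < N') `|braket (e j) psi| ^+ 2.
Let S (om : Om) : R[i] := overlap zeta c om.

Let q'_le1 : q' <= 1.
Proof. by apply: le_trans (bessel e_on psi) _; rewrite psi1 expr1n. Qed.

Let q'_ge0 : 0 <= q'.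
Proof. by apply: sumr_ge0 => j _; rewrite exprn_ge0. Qed.

Let head_q : \sum_(j in head_set) `|c j| ^+ 2 = q.
Proof.
rewrite /q (big_ord_widen N' (fun j => `|braket (e j) psi| ^+ 2) NN').
by apply: eq_bigl => j; rewrite inE.
Qed.

Let q_le_q' : q <= q'.
Proof.
rewrite -head_q big_mkcond; apply: ler_sum => j _.
by case: ifP => // _; rewrite exprn_ge0.
Qed.

Lemma coherent_prob om : braket Psi (coherent_op om Psi) =
  coherent_weight om * `|S om| ^+ (2 * n).
Proof.
rewrite coherent_op_form tens_braket prodr_const card_ord; congr (_ * _).
rewrite normrX -exprM [(n * 2)%N]mulnC; congr (`|_| ^+ _).
rewrite /coherent_vector braket_suml; apply: eq_bigr => j _.
by rewrite braketZl.
Qed.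

(** The last term is the part of [psi] beyond [N'], which no coherent vector sees. *)
Lemma coherent_pointwise_error om :
  `|S om| ^+ 2 * (1 - `|braket (normalized (e 0%N) (coherent_head om)) psi| ^+ 2) <=
  \sum_j `|(S om)^* * c j - (j \in head_set)%:R *
             prod_point zeta om j| ^+ 2 + `|S om| ^+ 2 * (1 - q').
Proof.
have := normalized_error e0_unit (coherent_head om) ((S om)^* ) psi1.
rewrite norm_conjC (norm_orthonormal_dist e_on) normrZ psi1 mulr1 norm_conjC.
move=> /le_trans; apply; rewrite lerD //.
  by apply: ler_sum => j _; rewrite braketZr.
rewrite [leRHS]mulrBr mulr1 lerD2l lerN2 /q' mulr_sumr; apply: ler_sum => j _.
by rewrite braketZr normrM norm_conjC exprMn.
Qed.

Lemma coherent_mass_ge :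
  (1 - real_complex R eps) * q' ^+ n <= \sum_om coherent_weight om * `|S om| ^+ (2 * n).
Proof.
have := overlap_moment_ge momentE c ratio_ge.
rewrite -/nfact mulrAC -ler_pdivlMr // mulr_suml; congr (_ <= _).
by apply: eq_bigr => om _; rewrite /coherent_weight mulrAC.
Qed.

Lemma coherent_mass_le1 : \sum_om coherent_weight om * `|S om| ^+ (2 * n) <= 1.
Proof.
have := coherent_op_sum_le Psi.
rewrite norm_tens psi1 prodr_const card_ord !expr1n; congr (_ <= _).
by apply: eq_bigr => om _; rewrite -coherent_op_form coherent_prob.
Qed.

(** Of the [n] factors [|S|^2] in the outcome probability, one pays for the pointwise error and [m]
    remain for [coherent_error_le]. The bias [1 - q] appears twice: once from that lemma, once as a
    bound for [1 - q']. *)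
Lemma coherent_error_sum :
  \sum_om coherent_weight om * `|S om| ^+ (2 * n) *
     (1 - `|braket (normalized (e 0%N) (coherent_head om)) psi| ^+ 2) <=
  (1 + N%:R) / n%:R + 2 * (1 - q).
Proof.
set a := fun j : 'I_N' => (j \in head_set)%:R : R[i].
have term om : coherent_weight om * `|S om| ^+ (2 * n) *
     (1 - `|braket (normalized (e 0%N) (coherent_head om)) psi| ^+ 2) <=
   coherent_weight om * (`|S om| ^+ (2 * m) *
     \sum_j `|(S om)^* * c j - a j * prod_point zeta om j| ^+ 2) +
   coherent_weight om * `|S om| ^+ (2 * n) * (1 - q').
  rewrite -[leLHS]mulrA -[X in _ <= _ + X]mulrA -mulrDr ler_wpM2l ?weight_ge0 //.
  rewrite mulnS addnC exprD -[leLHS]mulrA -[X in _ <= _ + X]mulrA -mulrDr.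
  by rewrite ler_wpM2l ?exprn_ge0 //; apply: coherent_pointwise_error.
apply: le_trans (ler_sum _ (fun om _ => term om)) _; rewrite big_split /=.
rewrite -mulr_suml (_ : _ + 2 * (1 - q) = ((1 + N%:R) / n%:R + (1 - q)) + (1 - q)); last first.
  by ring.
apply: lerD; last first.
  apply: (@le_trans _ _ (1 - q')); last by rewrite lerD2l lerN2.
  by rewrite ler_piMl ?subr_ge0 //; apply: coherent_mass_le1.
have := coherent_error_le momentE ratio_le1 head_set q'_le1.
rewrite head_q -/nfact -ler_pdivrMl // mulr_sumr => err.
have card_head : #|head_set| = N.
  rewrite -sum1_card -[RHS]card_ord -[RHS]sum1_card (big_ord_widen N' (fun=> 1%N) NN').
  by apply: eq_bigl => j; rewrite inE.
rewrite card_head in err; apply: le_trans err; rewrite le_eqVlt; apply/predU1P; left.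
by apply: eq_bigr => om _; rewrite [RHS]mulrA [nfact^-1 * _]mulrC.
Qed.

Lemma coherent_risk_le : (risk coherent_estimator dist (ketbra psi) <=
  (4 * ((1 + N%:R) / n%:R + 2 * (1 - complex.Re q) +
     (1 - (1 - eps) * complex.Re q' ^+ n)))%:E)%E.
Proof.
rewrite (risk_fin _ _ _ e_basis) lee_fin -lecR.
have qE : real_complex R (complex.Re q) = q.
  by apply: RRe_real; apply: ger0_real; apply: sumr_ge0 => j _; rewrite exprn_ge0.
have q'E : real_complex R (complex.Re q') = q' by apply/RRe_real/ger0_real.
have -> : real_complex R (4 * ((1 + N%:R) / n%:R + 2 * (1 - complex.Re q) +
    (1 - (1 - eps) * complex.Re q' ^+ n))) =
    4 * ((1 + N%:R) / n%:R + 2 * (1 - q) + (1 - (1 - real_complex R eps) * q' ^+ n)).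
  rewrite !(rmorphM, rmorphD, rmorphN, rmorphXn, fmorphV, rmorph1) /=.
  by rewrite !rmorph_nat qE q'E.
rewrite rmorph_sum /=.
(* The remainder outcome gives no information and is charged 4. *)
pose p (o : option 'I_#|Om|) : R[i] :=
  if o is Some k then braket Psi (coherent_op (enum_val k) Psi) *
    (4 * (1 - `|braket (normalized (e 0%N) (coherent_head (enum_val k))) psi| ^+ 2))
  else 4 * braket Psi (remainder_op Psi).
apply: (@le_trans _ _ (\sum_(j < #|Om|.+1) p (unlift ord0 j))).
  apply: ler_sum => j _; have [_ /(_ Psi) p_ge0] := coherent_family_psd j.
  rewrite rmorphM /= RRe_real ?ger0_real //; move: p_ge0.
  rewrite /coherent_out valK /= /coherent_family /p.
  case: unlift => [k|] p_ge0.
    rewrite ler_wpM2l //; apply: pure_state_distance_le => //.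
      exact: e_basis.
    exact: norm_normalized.
  rewrite mulrC ler_wpM2r //.
  apply: le_trans (pure_state_distance_le e_basis e0_unit psi1 dist_le) _.
  by rewrite ler_piMr // gerBl exprn_ge0.
rewrite coherent_family_big /p -/p addrC [leRHS]mulrDr; apply: lerD.
  rewrite (eq_bigr (fun om => 4 * (coherent_weight om * `|S om| ^+ (2 * n) *
     (1 - `|braket (normalized (e 0%N) (coherent_head om)) psi| ^+ 2)))) => [|om _].
    by rewrite -mulr_sumr ler_wpM2l // coherent_error_sum.
  by rewrite enum_rankK coherent_prob mulrCA.
rewrite ler_wpM2l // remainder_op_form norm_tens psi1 prodr_const card_ord !expr1n.
rewrite lerD2l lerN2; apply: le_trans coherent_mass_ge _; rewrite le_eqVlt.
by apply/predU1P; left; apply: eq_bigr => om _; rewrite -coherent_prob coherent_op_form.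
Qed.

End CoherentEstimator.

(** * The rate over a Sobolev class *)

Section SobolevTail.
Variables (R : realType) (H : hilbert R) (e : nat -> H).
Hypothesis e_basis : orthonormal_basis e.
Variables (alpha L : R) (psi : H).
Hypothesis alpha_gt0 : 0 < alpha.
Hypothesis psi1 : `|psi| = 1.
Hypothesis psi_sobolev : (\sum_(0 <= j <oo)
  (Normc.normc (braket (e j) psi) ^+ 2 * j%:R `^ (2 * alpha))%:E <= L%:E)%E.

Let r (j : nat) : R := Normc.normc (braket (e j) psi) ^+ 2.

Let head N : complex.Re (\sum_(j < N) `|braket (e j) psi| ^+ 2) = \sum_(j < N) r j.
Proof.
rewrite (_ : \sum_(j < N) _ = real_complex R (\sum_(j < N) r j)) //.
by rewrite rmorph_sum; apply: eq_bigr => j _; rewrite rmorphXn.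
Qed.

(** From [N] on, the Sobolev weight is at least that of [N]. The tail is expressed as 1 minus the
    head, so Parseval must supply a finite [M] beyond which almost no mass is left. *)
Lemma sobolev_tail N :
  N%:R `^ (2 * alpha) * (1 - complex.Re (\sum_(j < N) `|braket (e j) psi| ^+ 2)) <= L.
Proof.
rewrite head; have r_ge0 j : 0 <= r j by rewrite sqr_ge0.
have NM M : (N <= M)%N ->
    N%:R `^ (2 * alpha) * (\sum_(j < M) r j - \sum_(j < N) r j) <= L.
  move=> NM; rewrite -lee_fin; apply: le_trans psi_sobolev.
  apply: le_trans (nneseries_lim_ge M _); last first.
    by move=> k _ _; rewrite lee_fin mulr_ge0 ?sqr_ge0 ?powR_ge0.
  rewrite sumEFin lee_fin -!(big_mkord xpredT r) (big_cat_nat (leq0n N) NM) /=.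
  rewrite addrAC subrr add0r (big_cat_nat (leq0n N) NM) /= mulr_sumr.
  apply: (@le_trans _ _ (\sum_(N <= j < M) r j * j%:R `^ (2 * alpha))); last first.
    by rewrite lerDr sumr_ge0 // => j _; rewrite mulr_ge0 ?sqr_ge0 ?powR_ge0.
  rewrite !big_nat; apply: ler_sum => j /andP[Nj _].
  rewrite mulrC ler_wpM2l //; apply: ge0_ler_powR; rewrite ?nnegrE ?ler0n ?ler_nat //.
  by rewrite mulr_ge0 ?ltW.
apply/ler_addgt0Pr => d d_gt0.
(* The neglected mass is kept below [d / (P + 1)], so that even multiplied by [P] it stays below
   [d]; the 1 covers [P = 0]. *)
pose P := N%:R `^ (2 * alpha) : R.
have P1 : 0 < P + 1 by rewrite ltr_wpDl ?powR_ge0.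
have := (@cvgrPdist_lt _ R[i]^o _ _ _ _ _).1 (@parseval R H nat e e_basis psi psi)
  (real_complex R (d / (P + 1))).
rewrite ltcR divr_gt0 // => /(_ _ isT) [M0 _ HM0].
have /HM0 : (M0 <= maxn M0 N)%N by exact: leq_maxl.
rewrite (_ : \sum_(k < _) _ = real_complex R (\sum_(j < maxn M0 N) r j)); last first.
  rewrite rmorph_sum; apply: eq_bigr => j _; rewrite rmorphXn.
  rewrite (_ : basis_seq e j = e j); last exact: (basis_seq_pickle e j).
  by rewrite -(braketC (e j)) mulrC -normCK.
rewrite braket_norm psi1 expr1n => near1.
have {}near1 : 1 - \sum_(j < maxn M0 N) r j < d / (P + 1).
  rewrite -ltcR; apply: le_lt_trans near1; rewrite rmorphB rmorph1.
  apply: real_ler_norm; apply/complex_realP.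
  by exists (1 - \sum_(j < maxn M0 N) r j); rewrite rmorphB rmorph1.
have := NM _ (leq_maxr M0 N); rewrite -/P.
set s := \sum_(j < maxn M0 N) r j in near1 *.
set t := \sum_(j < N) r j => PL.
have Pd : P * (1 - s) <= d.
  apply: (@le_trans _ _ (P * (d / (P + 1)))); first by rewrite ler_wpM2l ?powR_ge0 // ltW.
  by rewrite mulrA ler_pdivrMr // mulrC ler_wpM2l ?(ltW d_gt0) // lerDl.
by lra.
Qed.

End SobolevTail.

(** Supplies the value at [n = 0], which the limsup ignores. *)
Lemma trivial_estimator (R : realType) (H : hilbert R) (e : nat -> H) (n : nat)
  (K : tensor_power H n) : orthonormal_basis e -> estimator K.
Proof.
move=> e_basis.
have id_psd (j : 'I_1) : psd (id : K -> K).
  by split=> [|x]; [exact: bounded_op_id|exact: braket_ge0].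
have id_sum (x : K) : \sum_(j < 1) x = x by rewrite big_ord1.
have e0_pure (w : nat) : pure_states H (ketbra (e 0%N)).
  exists (e 0%N) => //=; apply/eqP.
  by rewrite -(@eqrXn2 _ 2) // -braket_norm e_basis.1 expr1n.
exact: (@fin_estimator R H n K 1 (fun=> id) id_psd id_sum (fun=> ketbra (e 0%N)) e0_pure).
Qed.

Lemma one_sub_mul_exp_le (R : realDomainType) (eps p : R) (n : nat) :
  0 <= eps -> 0 <= p <= 1 -> 1 - (1 - eps) * p ^+ n <= eps + n%:R * (1 - p).
Proof.
move=> eps_ge0 /andP[p_ge0 p_le1].
have p1 : 0 <= 1 - p <= 1 by rewrite subr_ge0 p_le1 gerBl.
have := bernoulli_le n p1; rewrite subKr.
have : eps * p ^+ n <= eps by rewrite ler_piMr // exprn_ile1.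
by lra.
Qed.

Lemma coherent_estimator_rate (R : realType) (alpha L : R) (H : hilbert R)
    (e : nat -> H) (n : nat) (K : tensor_power H n) :
  0 < alpha -> 0 < L -> orthonormal_basis e -> (0 < n)%N ->
  exists est : estimator K, forall dist : (H -> H) -> (H -> H) -> R,
    dist = @trdist R H \/ dist = @bures R H ->
    forall rho, sobolev_class e alpha L rho ->
    ((n%:R `^ (2 * alpha / (2 * alpha + 1)))%:E * risk est dist rho <=
     (20 + 8 * L)%:E)%E.
Proof.
move=> alpha_gt0 L_gt0 e_basis; case: n K => // m K _.
(* After multiplication by the rate, 3 bounds the estimation error, [L] the truncation bias and 2
   the remainder. *)
have total_le (a b c : R) : a <= 3 -> b <= L -> c <= 2 ->
    4 * (a + 2 * b + c) <= 20 + 8 * L by move=> *; lra.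
pose x : R := m.+1%:R; have x_ge1 : 1 <= x by rewrite ler1n.
have x_gt0 : 0 < x by apply: lt_le_trans x_ge1.
(* The balance is [G x^beta = x] with [G = (x^beta)^(2 alpha)]: at [N] close to [x^beta], both
   [N / x] and [N^(-2 alpha)] are of order [1 / G]. *)
pose beta := (2 * alpha + 1)^-1; pose G := x `^ (2 * alpha / (2 * alpha + 1)).
have a1_gt0 : 0 < 2 * alpha + 1 by rewrite addr_gt0 ?mulr_gt0.
have beta_ge0 : 0 <= beta by rewrite invr_ge0 ltW.
have G_ge0 : 0 <= G by apply: powR_ge0.
have GE : G = (x `^ beta) `^ (2 * alpha) by rewrite -powRrM mulrC.
have xb_ge1 : 1 <= x `^ beta by rewrite -(powRr0 x) ler_powR.
have Gxb : G * x `^ beta = x.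
  rewrite -powRD; last by rewrite (gt_eqF x_gt0) implybT.
  by rewrite -[X in _ + X]mul1r -mulrDl divff ?powRr1 ?(ltW x_gt0) ?gt_eqF.
have G_le_x : G <= x by rewrite -[leRHS]Gxb ler_peMr.
pose N := (Num.truncn (x `^ beta)).+1.
(* This forces [L x^2 <= N'^(2 alpha)], hence [1 - q' <= x^-2], so that truncating [n] copies of
   [psi] loses at most [1 / x]. *)
pose N' := maxn N (Num.truncn ((L * x ^+ 2) `^ (2 * alpha)^-1)).+1.
have N_gt : x `^ beta <= N%:R by rewrite ltW // truncnS_gt.
have N_le : N%:R <= x `^ beta + 1.
  by rewrite -natr1 lerD2r truncn_le powR_ge0.
have N'_gt : L * x ^+ 2 <= N'%:R `^ (2 * alpha).
  have Lx : 0 <= L * x ^+ 2 by rewrite mulr_ge0 ?exprn_ge0 ?ltW.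
  have -> : L * x ^+ 2 = ((L * x ^+ 2) `^ (2 * alpha)^-1) `^ (2 * alpha).
    by rewrite -powRrM mulVf ?powRr1 // gt_eqF // mulr_gt0.
  apply: ge0_ler_powR; rewrite ?nnegrE ?powR_ge0 ?mulr_ge0 ?(ltW alpha_gt0) //.
  apply: le_trans (ltW (truncnS_gt _)) _; rewrite ler_nat; exact: leq_maxr.
(* A design defect of [1 / x] remains bounded after multiplication by the rate, since [G <= x]. *)
have eps_gt0 : 0 < x^-1 by rewrite invr_gt0.
have [D [w [zeta [mu [w_ge0 momentE ratio]]]]] :=
  @coherent_design R 'I_N' m.+1 x^-1 eps_gt0.
exists (coherent_estimator e_basis K N w_ge0 momentE (fun f => (ratio f).2)).
move=> dist dist_le rho [psi [psi1 psi_sob] <-].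
have NN' : (N <= N')%N by exact: leq_maxl.
have risk_le := coherent_risk_le e_basis K NN' w_ge0 momentE
  (fun f => (ratio f).1) (fun f => (ratio f).2) psi1 dist_le.
rewrite -/x -/G; apply: le_trans (lee_wpmul2l _ risk_le) _.
  by rewrite lee_fin.
have tail := sobolev_tail e_basis alpha_gt0 psi1 psi_sob.
have := tail N; have := tail N'.
set q := complex.Re (\sum_(j < N) _); set q' := complex.Re (\sum_(j < N') _).
move=> tailN' tailN; rewrite -EFinM lee_fin -/x.
have coord_bounds k : 0 <= complex.Re (\sum_(j < k) `|braket (e j) psi| ^+ 2) <= 1.
  have on (i j : 'I_k) : braket (e i) (e j) = (i == j)%:R by exact: e_basis.1.
  have s_ge0 : 0 <= \sum_(j < k) `|braket (e j) psi| ^+ 2.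
    by apply: sumr_ge0 => j _; rewrite exprn_ge0.
  have := bessel on psi; rewrite psi1 expr1n.
  rewrite -ler0c -lecR RRe_real ?ger0_real // => ->.
  by rewrite andbT.
have q'_bounds : 0 <= q' <= 1 by exact: coord_bounds.
have q_le1 : q <= 1 by case/andP: (coord_bounds N).
have one_sub_q' : x * (1 - q') <= x^-1.
  have : L * x ^+ 2 * (1 - q') <= L.
    by apply: le_trans tailN'; rewrite ler_wpM2r // subr_ge0; case/andP: q'_bounds.
  rewrite -mulrA ger_pMr // => h; rewrite -[leRHS]mul1r ler_pdivlMr //.
  by apply: le_trans h; rewrite expr2; lra.
have rem : G * (1 - (1 - x^-1) * q' ^+ m.+1) <= 2.
  apply: (@le_trans _ _ (x * (x^-1 + x^-1))); last by rewrite mulrDr divff ?gt_eqF.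
  apply: ler_pM => //.
    case/andP: (q'_bounds) => q'_ge0 q'_le1; rewrite subr_ge0.
    rewrite mulr_ile1 ?exprn_ge0 ?exprn_ile1 ?gerBl ?(ltW eps_gt0) //.
    by rewrite subr_ge0 invf_le1.
  apply: le_trans (one_sub_mul_exp_le _ (ltW eps_gt0) q'_bounds) _.
  by rewrite lerD2l.
(* Here [1 + N <= x^beta + 2 <= 3 x^beta], and [G x^beta = x]. *)
have head : G * ((1 + N%:R) / x) <= 3.
  rewrite mulrA ler_pdivrMr // -Gxb mulrCA ler_wpM2l //; lra.
have mid : G * (1 - q) <= L.
  apply: le_trans tailN; rewrite ler_wpM2r ?subr_ge0 // GE.
  apply: ge0_ler_powR; rewrite ?nnegrE ?powR_ge0 ?mulr_ge0 ?(ltW alpha_gt0) //.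
rewrite mulrCA.
rewrite (_ : G * _ = G * ((1 + N%:R) / x) + 2 * (G * (1 - q)) +
  G * (1 - (1 - x^-1) * q' ^+ m.+1)); last by ring.
exact: total_le head mid rem.
Qed.


Theorem theorem5p1 (R : realType) (alpha L : R)
    (alpha_gt0 : 0 < alpha) (L_gt0 : 0 < L) :
  exists2 C : R, 0 < C &
    forall (H : hilbert R) (e : nat -> H), orthonormal_basis e ->
    forall K : forall n : nat, tensor_power H n,
    exists est : forall n : nat, estimator (K n),
    forall dist : (H -> H) -> (H -> H) -> R,
      dist = @trdist R H \/ dist = @bures R H ->
      (limn_esup (fun n : nat =>
         ereal_sup [set (n%:R `^ (2 * alpha / (2 * alpha + 1)))%:E
                          * risk (est n) dist rho
                   | rho in sobolev_class e alpha L]) <= C%:E)%E.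
Proof.
exists (20 + 8 * L); first by rewrite addr_gt0 ?mulr_gt0.
move=> H e e_basis K.
have est n : {est : estimator (K n) | (0 < n)%N ->
    forall dist : (H -> H) -> (H -> H) -> R,
    dist = @trdist R H \/ dist = @bures R H ->
    forall rho, sobolev_class e alpha L rho ->
    ((n%:R `^ (2 * alpha / (2 * alpha + 1)))%:E * risk est dist rho <=
     (20 + 8 * L)%:E)%E}.
  apply: cid; case: (posnP n) => [->|n_gt0].
    by exists (trivial_estimator (K 0%N) e_basis).
  have [est0 est0P] := coherent_estimator_rate (K n) alpha_gt0 L_gt0 e_basis n_gt0.
  by exists est0.
exists (fun n => sval (est n)) => dist dist_le.
(* The limsup is an infimum over neighbourhoods of infinity; the positive integers form one, so a
   bound uniform in [n > 0] is enough. *)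
apply: le_trans (ereal_inf_lbound _) _.
  by exists [set n | (0 < n)%N] => //; exists 1%N.
apply: ge_ereal_sup => _ [n /= n_gt0 <-].
apply: ge_ereal_sup => _ [rho rho_sob <-].
exact: (svalP (est n)).
Qed.
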